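(* Let $k\ge1$ be an integer, let $\lambda_1,\dots,\lambda_k>0$, put $\Lambda=\sum_{j=1}^k\lambda_j$, and let $0<\theta<1$, $\eta>0$. Let $\{\mathscr D_{\eta,\theta}(t)\}_{t\ge0}$ be the tempered stable subordinator with stability index $\theta$ and tempering parameter $\eta$, let $\{M(t)\}_{t\ge0}$ be a generalized counting process with rates $\lambda_1,\dots,\lambda_k$ independent of $\mathscr D_{\eta,\theta}$, and let $\mathcal Z_{f_2}(t)=M(\mathscr D_{\eta,\theta}(t))$. Then the Lévy measure of $\mathcal Z_{f_2}$ is $$\Pi_{f_2}(\mathrm dx)=\frac{\theta}{\Gamma(1-\theta)}\sum_{n=1}^\infty\sum_{\Omega(k,n)}\prod_{j=1}^k\frac{\lambda_j^{x_j}}{x_j!}\,\frac{\Gamma(s_k-\theta)}{(\Lambda+\eta)^{s_k-\theta}}\,\delta_n(\mathrm dx),$$ where $\Omega(k,n)=\{(x_1,\dots,x_k)\in\mathbb N_0^k:x_1+2x_2+\dots+kx_k=n\}$, $s_k=x_1+x_2+\dots+x_k$, and $\delta_n$ is the Dirac measure at $n$.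
   Context: The generalized counting process (GCP) with positive rates $\lambda_1,\dots,\lambda_k$ is the counting process $\{M(t)\}_{t\ge0}$ with $M(0)=0$ that performs $k$ kinds of jumps of amplitude $1,2,\dots,k$ with rates $\lambda_1,\dots,\lambda_k$, respectively; equivalently it is (in law) the Lévy process $M(t)=\sum_{j=1}^k jN_j(t)$, where $N_1,\dots,N_k$ are independent Poisson processes with intensities $\lambda_1,\dots,\lambda_k$. The tempered stable subordinator (TSS) $\{\mathscr D_{\eta,\theta}(t)\}_{t\ge0}$ is the subordinator with Bernstein function $f_2(s)=(\eta+s)^\theta-\eta^\theta$, i.e. $\mathbb E(e^{-s\mathscr D_{\eta,\theta}(t)})=e^{-tf_2(s)}$, $s>0$. *)

(* Defs.v *)
From HB Require Import structures.
From mathcomp Require Import all_boot all_order all_algebra.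
From mathcomp Require Import all_classical all_reals all_analysis.
From mathcomp Require Export complex.

Set Implicit Arguments.
Unset Strict Implicit.
Unset Printing Implicit Defensive.

Import Order.TTheory GRing.Theory Num.Theory.
Import numFieldNormedType.Exports.

Local Open Scope classical_set_scope.
Local Open Scope ring_scope.

Definition Gamma (R : realType) (a : R) : R :=
  \int[lebesgue_measure]_(x in `]0, +oo[) (x `^ (a - 1) * expR (- x)).

Definition cexp (R : realType) (z : R[i]) : R[i] :=
  ((expR (complex.Re z) * cos (complex.Im z))
    +i* (expR (complex.Re z) * sin (complex.Im z)))%C.

Definition cintegral (R : realType) (d : measure_display)
    (T : measurableType d) (mu : {measure set T -> \bar R})
    (f : T -> R[i]) : R[i] :=
  ((\int[mu]_x complex.Re (f x)) +i* (\int[mu]_x complex.Im (f x)))%C.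

Definition characteristic_function (R : realType) (d : measure_display)
    (T : measurableType d) (P : probability T R) (X : T -> R) (u : R) : R[i] :=
  cintegral P (fun w => cexp (0 +i* (u * X w))%C).

(* A process is a family X t of real functions on T.  It is indexed by all the
   reals, but only the times t >= 0 are meaningful. *)

Definition mutually_independent (R : realType) (d : measure_display)
    (T : measurableType d) (P : probability T R) (n : nat)
    (Y : 'I_n -> T -> R) : Prop :=
  forall A : 'I_n -> set R, (forall i, measurable (A i)) ->
    P (\bigcap_(i in [set: 'I_n]) (Y i @^-1` A i)) =
    (\prod_(i < n) P (Y i @^-1` A i))%E.

Definition process_sigma (R : realType) (d : measure_display)
    (T : measurableType d) (X : R -> T -> R) : set (set T) :=
  <<s [set A | exists t (B : set R),
        [/\ 0 <= t, measurable B & A = X t @^-1` B] ]>>.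

Definition independent_processes (R : realType) (d : measure_display)
    (T : measurableType d) (P : probability T R) (X Y : R -> T -> R) : Prop :=
  forall A B, process_sigma X A -> process_sigma Y B ->
    P (A `&` B) = (P A * P B)%E.

Definition cadlag (R : realType) (f : R -> R) : Prop :=
  forall t, 0 <= t ->
    f @ t^'+ --> f t /\ (0 < t -> cvg (f @ t^'-)).

(* Stochastic continuity is not listed: it follows from right-continuity and
   the stationarity of the increments. *)
Record levy_process (R : realType) (d : measure_display)
    (T : measurableType d) (P : probability T R) (X : R -> T -> R) : Prop := {
  levy_measurable : forall t, 0 <= t -> measurable_fun setT (X t) ;
  levy_start : forall w, X 0 w = 0 ;
  levy_cadlag : forall w, cadlag (X ^~ w) ;
  levy_independent : forall (n : nat) (t : nat -> R),
    0 <= t 0%N -> (forall i, t i <= t i.+1) ->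
    mutually_independent P (fun (i : 'I_n) w => X (t i.+1) w - X (t i) w) ;
  levy_stationary : forall s t (A : set R), 0 <= s -> 0 <= t -> measurable A ->
    P ((fun w => X (s + t) w - X s w) @^-1` A) = P (X t @^-1` A)
}.

Definition nondecreasing_paths (R : realType) (T : Type) (X : R -> T -> R) :=
  forall w s t, 0 <= s -> s <= t -> X s w <= X t w.

(* Levy-Khintchine exponent of the triplet (b, a, nu), with truncation
   function x |-> x 1_{|x| <= 1}; a is the Gaussian variance. *)
Definition levy_exponent (R : realType) (b a : R)
    (nu : {measure set (measurableTypeR R) -> \bar R}) (u : R) : R[i] :=
  ((- (a * u ^+ 2 / 2)) +i* (b * u))%C +
  cintegral nu (fun x : R =>
    cexp (0 +i* (u * x))%C - 1 -
    (0 +i* (u * x * (if `|x| <= 1 then 1 else 0)))%C).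

Definition is_levy_measure (R : realType) (d : measure_display)
    (T : measurableType d) (P : probability T R) (X : R -> T -> R)
    (nu : {measure set (measurableTypeR R) -> \bar R}) : Prop :=
  [/\ levy_process P X,
      nu [set 0] = 0%E,
      (\int[nu]_x (Num.min 1 (x ^+ 2))%:E < +oo)%E
    & exists b a : R, 0 <= a /\
        forall t u, 0 <= t ->
          characteristic_function P (X t) u =
          cexp ((t +i* 0)%C * levy_exponent b a nu u) ].

Record subordinator (R : realType) (d : measure_display)
    (T : measurableType d) (P : probability T R) (D : R -> T -> R) : Prop := {
  subordinator_levy : levy_process P D ;
  subordinator_nondecreasing : nondecreasing_paths D
}.

Record tempered_stable_subordinator (R : realType) (d : measure_display)
    (T : measurableType d) (P : probability T R) (eta theta : R)
    (D : R -> T -> R) : Prop := {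
  tss_subordinator : subordinator P D ;
  tss_laplace : forall s t, 0 < s -> 0 <= t ->
    \int[P]_w expR (- (s * D t w)) =
    expR (- (t * ((eta + s) `^ theta - eta `^ theta)))
}.

(* Jumps of amplitude 1, ..., k: the index j : 'I_k stands for the amplitude
   j.+1.  The rates are the infinitesimal ones, as h tends to 0 from the right:
   P (M h = j) = lambda_j h + o(h) for 1 <= j <= k, and P (M h > k) = o(h). *)
Record generalized_counting_process (R : realType) (d : measure_display)
    (T : measurableType d) (P : probability T R) (k : nat)
    (lambda : 'I_k -> R) (M : R -> T -> R) : Prop := {
  gcp_levy : levy_process P M ;
  gcp_nondecreasing : nondecreasing_paths M ;
  gcp_nat : forall t w, 0 <= t -> exists n : nat, M t w = n%:R ;
  gcp_rate : forall j : 'I_k,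
    (fun h => fine (P [set w | M h w = j.+1%:R]) / h) @ 0^'+ --> lambda j ;
  gcp_no_larger_jump :
    (fun h => fine (P [set w | k%:R < M h w]) / h) @ 0^'+ --> (0 : R)
}.

(* The coordinate x_j of the mathematical text is x applied to the ordinal of
   value j - 1.  The set is finite. *)
Definition Omega (k n : nat) : set {ffun 'I_k -> nat} :=
  [set x : {ffun 'I_k -> nat} | (\sum_(j < k) j.+1 * x j)%N = n].
Arguments Omega : clear implicits.

(* Main.v *)
From HB Require Import structures.
Require Import Defs.
From mathcomp Require Import all_boot all_order all_algebra.
From mathcomp Require Import all_classical all_reals all_analysis.
From mathcomp Require Import measurable_realfun ring lra.
Import Order.TTheory GRing.Theory Num.Theory.
Import numFieldNormedType.Exports.
Local Open Scope classical_set_scope.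
Local Open Scope ring_scope.
Set Implicit Arguments.
Unset Strict Implicit.
Unset Printing Implicit Defensive.

(** Let f(s) = (eta + s)^theta - eta^theta be the Bernstein function of D, let
    psi(v) = sum_j lambda_j (1 - e^(-v j)), and let Pi be the announced measure.
    The measure Pi is recovered as the limit of P(Z_h in dx) / h as h tends to 0
    from the right.

    Z is again a Levy process: freezing the path of D by Tonelli's theorem turns
    its increments into increments of M over deterministic time intervals
    ([subordinated_levy]).  The transform phi_t(u) = E exp(i u X_t) of a Levy
    process X satisfies phi_(s + t) = phi_s phi_t and has modulus at most 1, so it
    is exp(t c) as soon as (phi_h - 1) / h tends to c.  It is therefore enough to
    know the limit of E g(X_h) / h for bounded g vanishing at 0
    ([levy_transform_small_time]).

    For M this limit is sum_j lambda_j g(j), by definition of the rates.  Hence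
    E exp(-v M_t) = exp(-t psi(v)), and averaging over D gives
    E exp(-v Z_t) = exp(-t f(psi(v))) ([subordinated_laplace]).  So for
    g(x) = 1 - e^(-v x) the limit of E g(Z_h) / h is f(psi(v)).

    This number is also the integral of g against Pi, because the Laplace
    transform of Pi is explicit.  Put a = Lambda + eta and
    S = sum_j lambda_j e^(-v j).  The factor Gamma(s - theta) / a^(s - theta) is
    the integral of y^(s - theta - 1) e^(-a y) over y > 0; under that integral the
    sums over n and Omega(k, n) rebuild the exponential series of S y, and what
    remains is the integral of y^(-theta - 1) (e^(-(a - S) y) - e^(-a y)), that is
    Gamma(1 - theta) / theta * (a^theta - (a - S)^theta), where
    a - S = eta + psi(v) ([levy_weight_series]).  So the Laplace transform of Pi at
    v is a^theta - (eta + psi(v))^theta, which differs from its value at v = 0,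
    the total mass, by f(psi(v)).

    Finally g |-> E g(Z_h) / h and g |-> int g dPi are positive functionals that
    see g only at the naturals.  For such functionals, convergence at
    x |-> 1 - e^(-v x) for all v > 0 gives convergence at all bounded g vanishing
    at 0, the tails of the finite measure Pi being small ([laplace_cvg]).  The
    functions cos(u x) - 1 and sin(u x) then give the Levy-Khintchine exponent of Z. *)

(** * Expectations of products of independent variables *)

Lemma integral_indic_comp (R : realType) (d : measure_display)
    (T : measurableType d) (P : probability T R) (Y : T -> R) (A : set R) :
  measurable_fun setT Y -> measurable A ->
  (\int[P]_w (\1_A (Y w))%:E = P (Y @^-1` A))%E.
Proof.
move=> mY mA.
rewrite (_ : (fun w => _) = (fun w => (\1_(Y @^-1` A) w)%:E)) //.
by rewrite integral_indic ?setIT// -[X in measurable X]setTI; exact: mY.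
Qed.

Lemma prod_indic (R : realType) (T : Type) (n : nat) (Y : 'I_n -> T -> R)
    (A : 'I_n -> set R) (w : T) :
  \prod_(i < n) \1_(A i) (Y i w) =
  \1_(\bigcap_(i in [set: 'I_n]) (Y i @^-1` A i)) w :> R.
Proof.
rewrite indicE; have [/set_mem wA|/negP wA] := boolP (w \in _).
  by rewrite big1// => i _; rewrite indicE mem_set//; exact: wA.
have [i wi] : exists i, ~ A i (Y i w).
  by apply/existsNP => h; apply: wA; apply/mem_set => i _; exact: h.
by rewrite (bigD1 i)//= indicE memNset ?mul0r.
Qed.

Import HBNNSimple.

(** Both sides are linear in [f] and continuous along increasing limits, so the
    case of indicators propagates to simple functions, then to all nonnegative
    measurable functions.  The weight [W] stands for the factors of a product
    that do not involve [Y], and [c] for their expectation. *)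
Lemma integral_comp_weight (R : realType) (d : measure_display)
    (T : measurableType d) (P : probability T R) (W : T -> R)
    (Y Y' : T -> R) (c : R) :
  (forall w, 0 <= W w) -> measurable_fun setT W -> 0 <= c ->
  measurable_fun setT Y -> measurable_fun setT Y' ->
  (forall A : set R, measurable A ->
     (\int[P]_w (W w * \1_A (Y w))%:E = c%:E * P (Y' @^-1` A))%E) ->
  forall f : R -> R, (forall x, 0 <= f x) -> measurable_fun setT f ->
  (\int[P]_w (W w * f (Y w))%:E = c%:E * \int[P]_w (f (Y' w))%:E)%E.
Proof.
move=> W0 mW c0 mY mY' WA f f0 mf.
have mf' : measurable_fun setT (EFin \o f) by exact/measurable_EFinP.
pose g := nnsfun_approx measurableT mf'.
have gnd n m x : (n <= m)%N -> g n x <= g m x.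
  by move=> nm; have /lefP := @nd_nnsfun_approx _ _ _ _ measurableT _ mf' n m nm; exact.
have gcv x : (g n x)%:E @[n --> \oo] --> (f x)%:E.
  apply: (@cvg_nnsfun_approx _ _ _ _ measurableT _ mf') => //=.
  by move=> y _; rewrite lee_fin.
have mWgY n : measurable_fun setT (fun w => (W w * g n (Y w))%:E).
  by apply/measurable_EFinP/measurable_funM => //; apply: measurableT_comp.
have mgY' n : measurable_fun setT (fun w => (g n (Y' w))%:E).
  by apply/measurable_EFinP; apply: measurableT_comp.
have m1 (A : set R) : measurable A -> measurable_fun setT (\1_A : R -> R).
  by move=> mA; exact: measurable_indic.
have step n : (\int[P]_w (W w * g n (Y w))%:E = c%:E * \int[P]_w (g n (Y' w))%:E)%E.
  have mpre r : measurable (g n @^-1` [set r]) by [].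
  have g0 r w : (0 <= r%:E * (\1_(g n @^-1` [set r]) w)%:E)%E.
    exact: nnfun_muleindic_ge0.
  transitivity (\sum_(r \in range (g n))
      \int[P]_w (r%:E * (W w * \1_(g n @^-1` [set r]) (Y w))%:E))%E.
    rewrite -ge0_integral_fsum//.
    - apply: eq_integral => w _; rewrite EFinM fimfunE -fsumEFin//.
      rewrite ge0_mule_fsumr; last by move=> r; rewrite EFinM.
      by apply: eq_fsbigr => r _; rewrite EFinM muleCA -EFinM.
    - move=> r; apply: measurable_funeM; apply/measurable_EFinP/measurable_funM => //.
      by apply: measurableT_comp; [exact: m1|].
    - by move=> r w _; rewrite EFinM muleCA mule_ge0// lee_fin.
  transitivity (\sum_(r \in range (g n))
      c%:E * \int[P]_w (r%:E * (\1_(g n @^-1` [set r]) (Y' w))%:E))%E.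
    apply: eq_fsbigr => r /[!inE] -[x _ <-].
    have gx0 : (0 <= (g n x)%:E)%E by rewrite lee_fin.
    rewrite ge0_integralZl//; last 2 first.
    - apply/measurable_EFinP/measurable_funM => //.
      by apply: measurableT_comp; [exact: m1|].
    - by move=> w _; rewrite lee_fin mulr_ge0.
    rewrite ge0_integralZl//; last first.
      by apply/measurable_EFinP; apply: measurableT_comp; [exact: m1|].
    by rewrite WA// muleCA integral_indic_comp.
  rewrite -ge0_mule_fsumr; last first.
    by move=> r; apply: integral_ge0 => w _.
  congr *%E.
  rewrite -ge0_integral_fsum//.
  - by apply: eq_integral => w _; rewrite fimfunE -fsumEFin.
  - move=> r; apply: measurable_funeM; apply/measurable_EFinP.
    by apply: measurableT_comp; [exact: m1|].
transitivity (limn (fun n => \int[P]_w (W w * g n (Y w))%:E)%E).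
  rewrite -monotone_convergence//.
  - apply: eq_integral => w _; apply/esym/cvg_lim => //.
    under eq_fun do rewrite EFinM; rewrite EFinM; exact: cvgeZl.
  - by move=> n w _; rewrite lee_fin mulr_ge0.
  - by move=> w _ m n mn; rewrite lee_fin ler_wpM2l// gnd.
have ndI : {homo (fun n => \int[P]_w (g n (Y' w))%:E)%E : m n / (m <= n)%N >-> (m <= n)%E}.
  move=> m n mn; apply: ge0_le_integral => //.
  - by move=> w _; rewrite lee_fin.
  - by move=> w _; rewrite lee_fin gnd.
under eq_fun do rewrite step.
rewrite limeMl//; last exact: ereal_nondecreasing_is_cvgn.
congr *%E; rewrite -monotone_convergence//.
- by apply: eq_integral => w _; apply/cvg_lim.
- by move=> n w _; rewrite lee_fin.
- by move=> w _ m n mn; rewrite lee_fin gnd.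
Qed.

Lemma eq_law_integral (R : realType) (d : measure_display)
    (T : measurableType d) (P : probability T R) (Y Y' : T -> R) :
  measurable_fun setT Y -> measurable_fun setT Y' ->
  (forall A : set R, measurable A -> P (Y @^-1` A) = P (Y' @^-1` A)) ->
  forall f : R -> R, (forall x, 0 <= f x) -> measurable_fun setT f ->
  (\int[P]_w (f (Y w))%:E = \int[P]_w (f (Y' w))%:E)%E.
Proof.
move=> mY mY' YY' f f0 mf.
have := @integral_comp_weight R d T P (cst 1) Y Y' 1 _ _ _ mY mY' _ f f0 mf.
rewrite mul1e => <- //.
  by apply: eq_integral => w _; rewrite mul1r.
move=> A mA; rewrite mul1e -YY'//; under eq_integral do rewrite mul1r.
exact: integral_indic_comp.
Qed.

Lemma eq_law_Rintegral (R : realType) (d : measure_display)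
    (T : measurableType d) (P : probability T R) (Y Y' : T -> R) :
  measurable_fun setT Y -> measurable_fun setT Y' ->
  (forall A : set R, measurable A -> P (Y @^-1` A) = P (Y' @^-1` A)) ->
  forall f : R -> R, measurable_fun setT f ->
  \int[P]_w f (Y w) = \int[P]_w f (Y' w).
Proof.
move=> mY mY' YY' f mf; rewrite /Rintegral; congr fine.
rewrite [LHS]integralE [RHS]integralE; congr (_ - _)%E.
- have h w X : ((fun w => (f (X w))%:E)^\+ w = ((f^\+ (X w))%:E))%E.
    by rewrite funeposE /funrpos EFin_max.
  under eq_integral do rewrite h; under [RHS]eq_integral do rewrite h.
  by apply: eq_law_integral => //; exact: measurable_funrpos.
- have h w X : ((fun w => (f (X w))%:E)^\- w = ((f^\- (X w))%:E))%E.
    by rewrite funenegE /funrneg EFin_max.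
  under eq_integral do rewrite h; under [RHS]eq_integral do rewrite h.
  by apply: eq_law_integral => //; exact: measurable_funrneg.
Qed.

(** Independence is the case where every [f i] is an indicator.  The indicators
    are replaced by the functions one coordinate at a time; each replacement is
    [integral_comp_weight] with the product of the other factors as weight. *)
Lemma integral_prod_independent (R : realType) (d : measure_display)
    (T : measurableType d) (P : probability T R) (n : nat)
    (Y : 'I_n -> T -> R) (f : 'I_n -> R -> R) :
  (forall i, measurable_fun setT (Y i)) -> mutually_independent P Y ->
  (forall i, measurable_fun setT (f i)) -> (forall i x, 0 <= f i x <= 1) ->
  (\int[P]_w (\prod_(i < n) f i (Y i w))%:E =
   \prod_(i < n) \int[P]_w (f i (Y i w))%:E)%E.
Proof.
move=> mY iY.
have mfY (g : R -> R) i : measurable_fun setT g ->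
    measurable_fun setT (fun w => g (Y i w)).
  by move=> mg; exact: (measurableT_comp mg (mY i)).
(* The factors of index at least [j] are still indicators; [j = n] is the goal. *)
suff H j : forall f : 'I_n -> R -> R, (forall i, measurable_fun setT (f i)) ->
    (forall i x, 0 <= f i x <= 1) ->
    (forall i : 'I_n, (j <= i)%N -> exists2 A, measurable A & f i = \1_A) ->
  (\int[P]_w (\prod_(i < n) f i (Y i w))%:E =
   \prod_(i < n) \int[P]_w (f i (Y i w))%:E)%E.
  by move=> mf f01; apply: (H n) => // i; rewrite leqNgt ltn_ord.
clear f; elim: j => [f mf f01 fA|j IH f mf f01 fA].
  have [A HA] := choice (fun i => let: ex_intro2 A mA e := fA i isT in
    ex_intro (fun A => measurable A /\ f i = \1_A) A (conj mA e)).
  have e i w : f i (Y i w) = \1_(A i) (Y i w) by rewrite (HA i).2.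
  have mYA i : measurable (Y i @^-1` A i).
    by rewrite -[X in measurable X]setTI; apply: mY => //; exact: (HA i).1.
  transitivity (P (\bigcap_(i in [set: 'I_n]) (Y i @^-1` A i))).
    rewrite -[X in P X]setIT -integral_indic//; last first.
      by apply: fin_bigcap_measurable => [|i _]; [exact: finite_finset|exact: mYA].
    by apply: eq_integral => w _; congr EFin; under eq_bigr do rewrite e; exact: prod_indic.
  rewrite iY => [|i]; last exact: (HA i).1.
  apply: eq_bigr => i _; under eq_integral do rewrite e.
  by rewrite integral_indic_comp//; exact: (HA i).1.
have [nj|jn] := leqP n j.
  by apply: IH => // i ji; have := leq_trans nj ji; rewrite leqNgt ltn_ord.
pose j' := Ordinal jn.
pose W w := \prod_(i < n | i != j') f i (Y i w).
have fint i : (\int[P]_w (f i (Y i w))%:E \is a fin_num)%E.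
  rewrite ge0_fin_numE; last first.
    by apply: integral_ge0 => w _; rewrite lee_fin; case/andP: (f01 i (Y i w)).
  apply: (@le_lt_trans _ _ (\int[P]_w (cst 1%E w))%E).
    apply: ge0_le_integral => //.
    - by move=> w _; rewrite lee_fin; case/andP: (f01 i (Y i w)).
    - by apply/measurable_EFinP; exact: mfY.
    - by move=> w _; rewrite lee_fin; case/andP: (f01 i (Y i w)).
  rewrite integral_cst// mul1e; apply: le_lt_trans (ltry 1).
  exact: probability_le1.
pose c := \prod_(i < n | i != j') fine (\int[P]_w (f i (Y i w))%:E)%E.
have cE : (\prod_(i < n | i != j') \int[P]_w (f i (Y i w))%:E = c%:E)%E.
  rewrite /c -prodEFin; apply: eq_bigr => i _; by rewrite fineK.
rewrite (bigD1 j')//= cE muleC.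
have W0 w : 0 <= W w by apply: prodr_ge0 => i _; case/andP: (f01 i (Y i w)).
have c0 : 0 <= c.
  apply: prodr_ge0 => i _; apply: fine_ge0; apply: integral_ge0 => w _.
  by rewrite lee_fin; case/andP: (f01 i (Y i w)).
have f0 x : 0 <= f j' x by case/andP: (f01 j' x).
rewrite -(@integral_comp_weight _ _ _ P W (Y j') (Y j') c)//.
- by apply: eq_integral => w _; rewrite (bigD1 j')//= mulrC.
- rewrite /W; under eq_fun do rewrite big_mkcond.
  by apply: measurable_prod => i _ /=; case: (i != j'); [exact: mfY|exact: measurable_cst].
move=> A mA.
pose g (i : 'I_n) := if i == j' then \1_A else f i.
have gj i : i != j' -> g i = f i by rewrite /g => /negbTE ->.
have gj' : g j' = \1_A by rewrite /g eqxx.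
transitivity (\int[P]_w (\prod_(i < n) g i (Y i w))%:E)%E.
  apply: eq_integral => w _; rewrite (bigD1 j')//= mulrC gj'.
  by congr ((_ * _)%:E); apply: eq_bigr => i ij; rewrite gj.
rewrite IH.
- rewrite (bigD1 j')//= muleC -cE; congr *%E.
    by apply: eq_bigr => i ij; rewrite gj.
  by rewrite gj' integral_indic_comp.
- by move=> i; rewrite /g; case: eqP => // _; exact: measurable_indic.
- move=> i x; rewrite /g; case: eqP => // _.
  by rewrite indicE; case: (_ \in _); rewrite ?lexx ?ler01.
- move=> i ji; rewrite /g; case: eqVneq => [_|ij]; first by exists A.
  apply: fA; rewrite ltn_neqAle ji andbT.
  by apply: contra ij => /eqP e; apply/eqP/val_inj.
Qed.

Lemma bounded_integrable (R : realType) (d : measure_display)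
    (T : measurableType d) (mu : {measure set T -> \bar R}) (f : T -> R) (C : R) :
  (mu setT < +oo)%E -> measurable_fun setT f -> (forall w, `|f w| <= C) ->
  mu.-integrable setT (EFin \o f).
Proof.
move=> muT mf fC; apply: measurable_bounded_integrable => //.
exists C; split; first exact: num_real.
by move=> x Cx w _; exact: le_trans (fC w) (ltW Cx).
Qed.

Lemma probability_lty (R : realType) (d : measure_display)
    (T : measurableType d) (P : probability T R) : (P setT < +oo)%E.
Proof. by apply: le_lt_trans (probability_le1 P measurableT) (ltry 1). Qed.

(** The two variables are the increments over the times 0, s, s + t. *)
Lemma levy_pair (R : realType) (d : measure_display)
    (T : measurableType d) (P : probability T R) (X : R -> T -> R)
    (f g : R -> R) (s t : R) :
  levy_process P X -> 0 <= s -> 0 <= t ->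
  measurable_fun setT f -> measurable_fun setT g ->
  (forall x, 0 <= f x <= 1) -> (forall x, 0 <= g x <= 1) ->
  (\int[P]_w (f (X s w) * g (X (s + t) w - X s w))%:E =
   \int[P]_w (f (X s w))%:E * \int[P]_w (g (X t w))%:E)%E.
Proof.
move=> LX s0 t0 mf mg f01 g01.
(* Independence is stated for infinite sequences of times, hence the constant
   tail. *)
pose tm (i : nat) : R := if i is i'.+1 then (if i' is _.+1 then s + t else s) else 0.
have tmle i : tm i <= tm i.+1.
  by case: i => [|[|i]] //=; rewrite ?lerDl.
have tm0 i : 0 <= tm i by elim: i => // i /le_trans; apply.
have mX u : 0 <= u -> measurable_fun setT (X u) by exact: levy_measurable LX u.
have I2 := @levy_independent _ _ _ _ _ LX 2%N tm (lexx 0) tmle.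
pose F (i : 'I_2) : R -> R := if val i is 0%N then f else g.
have X0 w : X 0 w = 0 by exact: levy_start LX w.
transitivity (\int[P]_w (\prod_(i < 2) F i (X (tm i.+1) w - X (tm i) w))%:E)%E.
  apply: eq_integral => w _.
  by rewrite !big_ord_recl big_ord0 /F /= mulr1 X0 subr0.
rewrite (integral_prod_independent _ I2); last 3 first.
- by move=> i; apply: measurable_funB; apply: mX.
- by move=> i; rewrite /F; case: (val i).
- by move=> i x; rewrite /F; case: (val i).
rewrite !big_ord_recl big_ord0 /F /= mule1; congr *%E.
  by apply: eq_integral => w _; rewrite X0 subr0.
apply: eq_law_integral => //.
- by apply: measurable_funB; apply: mX => //; exact: addr_ge0.
- exact: mX.
- by move=> A mA; exact: levy_stationary.
- by move=> x; case/andP: (g01 x).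
Qed.

(** The map h |-> (1 + h) / 2 carries values in [-1, 1] to [0, 1], where
    [levy_pair] applies; expanding both products leaves the mixed term. *)
Lemma levy_pair_Rintegral (R : realType) (d : measure_display)
    (T : measurableType d) (P : probability T R) (X : R -> T -> R)
    (f g : R -> R) (s t : R) :
  levy_process P X -> 0 <= s -> 0 <= t ->
  measurable_fun setT f -> measurable_fun setT g ->
  (forall x, `|f x| <= 1) -> (forall x, `|g x| <= 1) ->
  \int[P]_w (f (X s w) * g (X (s + t) w - X s w)) =
  \int[P]_w f (X s w) * \int[P]_w g (X t w).
Proof.
move=> LX s0 t0 mf mg f1 g1.
have mX u : 0 <= u -> measurable_fun setT (X u) by exact: levy_measurable LX u.
have PT := probability_lty P.
have Xbnd (h : R -> R) (Y : T -> R) : measurable_fun setT h -> measurable_fun setT Y ->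
    (forall x, `|h x| <= 1) -> P.-integrable setT (EFin \o (fun w => h (Y w))).
  move=> mh mY h1; apply: (@bounded_integrable _ _ _ _ _ 1) => //.
  exact: (measurableT_comp mh mY).
pose Y w := X (s + t) w - X s w.
have mY : measurable_fun setT Y.
  by apply: measurable_funB; apply: mX => //; exact: addr_ge0.
have EgY : \int[P]_w g (Y w) = \int[P]_w g (X t w).
  apply: eq_law_Rintegral => //; first exact: mX.
  by move=> A mA; exact: levy_stationary.
pose sh (h : R -> R) x := (1 + h x) / 2.
have msh h : measurable_fun setT h -> measurable_fun setT (sh h).
  by move=> mh; apply: measurable_funM => //; exact: measurable_funD.
have sh01 h : (forall x, `|h x| <= 1) -> forall x, 0 <= sh h x <= 1.
  move=> h1 x; have := h1 x; rewrite ler_norml => /andP[h1x hx1].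
  rewrite /sh divr_ge0//=; last by rewrite addrC -lerBlDr sub0r.
  by rewrite ler_pdivrMr// mul1r (_ : 2 = 1 + 1)// lerD2l.
have i1 : P.-integrable setT (EFin \o (fun=> 1 : R)).
  exact: finite_measure_integrable_cst.
have E1 : \int[P]_w (1 : R) = 1.
  by rewrite Rintegral_cst// mul1r [X in fine X]probability_setT.
have Esh (h : R -> R) (Z : T -> R) : measurable_fun setT h -> measurable_fun setT Z ->
    (forall x, `|h x| <= 1) ->
    \int[P]_w sh h (Z w) = (1 + \int[P]_w h (Z w)) / 2.
  move=> mh mZ h1; have iZ := Xbnd h Z mh mZ h1.
  rewrite RintegralZr//; last first.
    by rewrite (_ : _ \o _ = (EFin \o (fun=> 1 : R)) \+ (EFin \o (fun w => h (Z w))))//;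
      exact: integrableD.
  by rewrite RintegralD// E1.
have if1 := Xbnd _ _ mf (mX _ s0) f1.
have ig1 := Xbnd _ _ mg mY g1.
have ifg : P.-integrable setT (EFin \o (fun w => f (X s w) * g (Y w))).
  apply: (@bounded_integrable _ _ _ _ _ 1) => //.
    by apply: measurable_funM; [exact: (measurableT_comp mf (mX _ s0))|
      exact: (measurableT_comp mg mY)].
  by move=> w; rewrite normrM mulr_ile1.
have iD (a b : T -> R) : P.-integrable setT (EFin \o a) -> P.-integrable setT (EFin \o b) ->
    P.-integrable setT (EFin \o (fun w => a w + b w)).
  by move=> ia ib; rewrite (_ : _ \o _ = (EFin \o a) \+ (EFin \o b))//; exact: integrableD.
have D0 := levy_pair LX s0 t0 (msh _ mf) (msh _ mg) (sh01 _ f1) (sh01 _ g1).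
have : \int[P]_w (sh f (X s w) * sh g (Y w)) = \int[P]_w sh f (X s w) * \int[P]_w sh g (X t w).
  have iF (h : R -> R) (Z : T -> R) : measurable_fun setT h -> measurable_fun setT Z ->
      (forall x, `|h x| <= 1) -> (\int[P]_w (sh h (Z w))%:E \is a fin_num)%E.
    move=> mh mZ h1; apply: integrable_fin_num => //.
    apply: Xbnd => // [|x]; first exact: msh.
    by have /andP[h0 h1'] := sh01 _ h1 x; rewrite ger0_norm.
  by rewrite /Rintegral -fineM ?D0//; apply: iF => //; exact: mX.
rewrite !Esh//; [|exact: mX|exact: mX].
have -> : \int[P]_w (sh f (X s w) * sh g (Y w)) =
    4^-1 * (1 + \int[P]_w f (X s w) + \int[P]_w g (Y w) + \int[P]_w (f (X s w) * g (Y w))).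
  transitivity (\int[P]_w (4^-1 * (1 + f (X s w) + g (Y w) + f (X s w) * g (Y w)))).
    apply: eq_Rintegral => w _; rewrite /sh; lra.
  have iA := iD _ _ i1 if1; have iB := iD _ _ iA ig1; have iC := iD _ _ iB ifg.
  by rewrite RintegralZl// RintegralD// RintegralD// RintegralD// E1.
rewrite EgY.
lra.
Qed.

(** * Freezing one of two independent processes *)

Section independent_pair.
Context (R : realType) (d d1 d2 : measure_display) (T : measurableType d)
  (T1 : measurableType d1) (T2 : measurableType d2) (P : probability T R)
  (p1 : {mfun T >-> T1}) (p2 : {mfun T >-> T2}).

Let p w := (p1 w, p2 w).
Let mp : measurable_fun setT p.
Proof. by apply: measurable_fun_pair. Qed.
Let p_mixin := isMeasurableFun.Build _ _ _ _ p mp.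
Let p12 : {mfun T >-> (T1 * T2)%type} := HB.pack p p_mixin.

Lemma integral_independent_pair :
  (forall A B, measurable A -> measurable B ->
     P (p1 @^-1` A `&` p2 @^-1` B) = P (p1 @^-1` A) * P (p2 @^-1` B))%E ->
  forall h : T1 * T2 -> \bar R, measurable_fun setT h -> (forall z, 0 <= h z)%E ->
  (\int[P]_w h (p1 w, p2 w) = \int[P]_w1 \int[P]_w2 h (p1 w1, p2 w2))%E.
Proof.
move=> ind h mh h0.
pose m1 : probability T1 R := distribution P p1.
pose m2 : probability T2 R := distribution P p2.
have E : forall A, measurable A -> (m1 \x m2)%E A = distribution P p12 A.
  by apply: product_measure_unique => A B mA mB; rewrite -ind.
transitivity (\int[distribution P p12]_z h z)%E.
  by rewrite ge0_integral_distribution.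
transitivity (\int[m1 \x m2]_z h z)%E.
  by apply: eq_measure_integral => A mA _; apply/esym/E.
rewrite fubini_tonelli1//.
rewrite ge0_integral_distribution//; last 2 first.
- exact: measurable_fun_fubini_tonelli_F.
- by move=> x; apply: integral_ge0.
apply: eq_integral => w _ /=; rewrite /fubini_F ge0_integral_distribution//.
exact: measurableT_comp.
Qed.
End independent_pair.

(** Independence of two processes is independence of the sigma-algebras that they
    generate.  [process_space X] is the sample space with the sigma-algebra of
    [X] alone, so that the independence of [X] and [Y] becomes the independence
    of the identity maps into [process_space X] and [process_space Y]. *)
Definition process_generator (R : realType) (d : measure_display)
    (T : measurableType d) (X : R -> T -> R) : set (set T) :=
  [set A | exists t (B : set R), [/\ 0 <= t, measurable B & A = X t @^-1` B] ].

Notation process_space X := (g_sigma_algebraType (process_generator X)).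

Lemma measurable_process_space (R : realType) (d : measure_display)
    (T : measurableType d) (X : R -> T -> R) (t : R) :
  0 <= t -> measurable_fun [set: process_space X] (X t : process_space X -> R).
Proof.
move=> t0 _ B mB; rewrite setTI; apply: sub_gen_smallest.
by exists t, B.
Qed.

Lemma measurable_to_process_space (R : realType) (d : measure_display)
    (T : measurableType d) (X : R -> T -> R) :
  (forall t, 0 <= t -> measurable_fun setT (X t)) ->
  measurable_fun setT (id : T -> process_space X).
Proof.
move=> mX _ B mB; rewrite setTI preimage_id; move: B mB.
apply: smallest_sub; first exact: sigma_algebra_measurable.
move=> _ [t [B [t0 mB ->]]].
by rewrite -[X in measurable X]setTI; exact: mX.
Qed.

(** By independence the diagonal map w |-> (w, w) into the product of the two
    process spaces has a product law; Tonelli's theorem then freezes the first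
    path while the second one is averaged. *)
Lemma integral_independent_processes (R : realType) (d : measure_display)
    (T : measurableType d) (P : probability T R) (M D : R -> T -> R) :
  (forall t, 0 <= t -> measurable_fun setT (M t)) ->
  (forall t, 0 <= t -> measurable_fun setT (D t)) ->
  independent_processes P M D ->
  forall h : process_space D * process_space M -> \bar R,
    measurable_fun setT h -> (forall z, 0 <= h z)%E ->
  (\int[P]_w h (w, w) = \int[P]_w1 \int[P]_w2 h (w1, w2))%E.
Proof.
move=> mM mD ind h mh h0.
pose pM : {mfun T >-> process_space M} := HB.pack (id : T -> process_space M)
  (isMeasurableFun.Build _ _ _ _ (id : T -> process_space M) (measurable_to_process_space mM)).
pose pD : {mfun T >-> process_space D} := HB.pack (id : T -> process_space D)
  (isMeasurableFun.Build _ _ _ _ (id : T -> process_space D) (measurable_to_process_space mD)).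
apply: (@integral_independent_pair _ _ _ _ T _ _ P pD pM) => //.
move=> A B mA mB; rewrite setIC muleC; exact: ind.
Qed.

(** Along nondecreasing right-continuous paths, M (tau) < c if and only if
    M q < c for some rational q > tau, so only countably many fixed times are
    involved. *)
Lemma measurable_process_comp (R : realType) (d d' : measure_display)
    (T : measurableType d) (U : measurableType d') (M : R -> T -> R) (tau : U -> R) :
  nondecreasing_paths M -> (forall w, cadlag (M ^~ w)) ->
  measurable_fun setT tau -> (forall u, 0 <= tau u) ->
  measurable_fun [set: U * process_space M] (fun z => M (tau z.1) z.2).
Proof.
move=> ndM cM mtau tau0.
apply: (measurability _ (RGenInftyO.measurableE R)) => //.
move=> _ [_ [c ->] <-]; rewrite setTI.
rewrite (_ : _ @^-1` _ = \bigcup_(q : rat)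
   ((tau \o fst) @^-1` `]-oo, ratr q[ `&`
    (M (Num.max 0 (ratr q)) \o snd) @^-1` `]-oo, c[)).
  apply: bigcupT_measurable_rat => q; apply: measurableI.
  - have := measurableT_comp mtau (@measurable_fst _ _ U (process_space M)).
    by move=> /(_ measurableT _ (measurable_itv `]-oo, ratr q[)); rewrite setTI.
  - have q0 : 0 <= Num.max 0 (ratr q) :> R by rewrite le_max lexx.
    have := measurableT_comp (@measurable_process_space _ _ _ M _ q0)
      (@measurable_snd _ _ U (process_space M)).
    by move=> /(_ measurableT _ (measurable_itv `]-oo, c[)); rewrite setTI.
apply/seteqP; split => z /=; last first.
  move=> [q _ /=]; rewrite !in_itv/= => -[tq Mc]; apply: le_lt_trans Mc; apply: ndM => //.
  by rewrite le_max (ltW tq) orbT.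
rewrite in_itv/= => Mc.
have [cMr _] := cM z.2 _ (tau0 z.1).
have : \forall s \near (tau z.1)^'+, M s z.2 < c.
  exact: (cvgr_lt _ cMr).
move=> [e /= e0 He].
have [q] := @rat_in_itvoo R (tau z.1) (tau z.1 + e) ltac:(by rewrite ltrDl).
rewrite in_itv/= => /andP[tq qe]; exists q => //=; rewrite !in_itv/=; split => //.
rewrite max_r ?(le_trans (tau0 z.1) (ltW tq))//.
apply: He => //=; rewrite distrC ger0_norm ?subr_ge0 ?(ltW tq)//.
by rewrite ltrBlDl.
Qed.

(** * Subordination preserves the Levy property *)

Section subordination.
Context (R : realType) (d : measure_display) (T : measurableType d)
  (P : probability T R) (M D : R -> T -> R).
Hypotheses (LM : levy_process P M) (ndM : nondecreasing_paths M).
Hypotheses (LD : levy_process P D) (ndD : nondecreasing_paths D).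
Hypothesis ind : independent_processes P M D.

Let mM t : 0 <= t -> measurable_fun setT (M t). Proof. exact: (levy_measurable LM). Qed.
Let mD t : 0 <= t -> measurable_fun setT (D t). Proof. exact: (levy_measurable LD). Qed.

Lemma subordinator_ge0 t w : 0 <= t -> 0 <= D t w.
Proof. by move=> t0; have := ndD w (lexx 0) t0; rewrite (levy_start LD). Qed.
Let D0 := subordinator_ge0.

Let Z t w := M (D t w) w.

Lemma measurable_process_comp_diag (d' : measure_display) (U : measurableType d')
    (tau : U -> R) : measurable_fun setT tau -> (forall u, 0 <= tau u) ->
  measurable_fun [set: U * T] (fun z => M (tau z.1) z.2).
Proof.
move=> mtau tau0.
have mJ := measurable_process_comp ndM (levy_cadlag LM) mtau tau0.
have mid := measurable_to_process_space mM.
have mp : measurable_fun setT (fun z : U * T => (z.1, z.2 : process_space M)).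
  apply: measurable_fun_pair; first exact: measurable_fst.
  exact: (measurableT_comp mid measurable_snd).
exact: (measurableT_comp mJ mp).
Qed.

Lemma measurable_subordinated t : 0 <= t -> measurable_fun setT (Z t).
Proof.
move=> t0.
have mJ := measurable_process_comp_diag (mD t0) (fun w => D0 w t0).
have mp : measurable_fun setT (fun w : T => (w, w)) by apply: measurable_fun_pair.
exact: (measurableT_comp mJ mp).
Qed.

(** The time is clamped at 0 to make the function measurable on the whole line. *)
Definition hit_prob (A : set R) (s : R) : R := fine (P (M (Num.max 0 s) @^-1` A)).

Let mpre (Y : T -> R) (A : set R) : measurable_fun setT Y -> measurable A ->
  measurable (Y @^-1` A).
Proof. by move=> mY mA; rewrite -[X in measurable X]setTI; exact: mY. Qed.

Let max0 (s : R) : 0 <= Num.max 0 s. Proof. by rewrite le_max lexx. Qed.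

Lemma hit_probE A s : measurable A -> 0 <= s ->
  ((hit_prob A s)%:E = P (M s @^-1` A))%E.
Proof.
move=> mA s0; rewrite /hit_prob max_r// fineK//; apply: fin_num_measure.
by apply: mpre => //; exact: mM.
Qed.

Lemma hit_prob01 A s : measurable A -> 0 <= hit_prob A s <= 1.
Proof.
move=> mA; rewrite -!lee_fin.
have -> : hit_prob A s = hit_prob A (Num.max 0 s) by rewrite /hit_prob maxA maxxx.
rewrite hit_probE// measure_ge0/= probability_le1//.
by apply: mpre => //; exact: mM.
Qed.

Lemma measurable_hit_prob A : measurable A -> measurable_fun setT (hit_prob A).
Proof.
move=> mA; apply/measurable_EFinP.
have mx : measurable_fun [set: R] (fun s : R => Num.max 0 s).
  by apply: measurable_maxr.
have mJ := measurable_process_comp_diag mx max0.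
pose h (z : R * T) : \bar R := (\1_A (M (Num.max 0 z.1) z.2))%:E.
have mh : measurable_fun setT h.
  by apply/measurable_EFinP; apply: (measurableT_comp _ mJ); exact: measurable_indic.
have h0 z : (0 <= h z)%E by rewrite lee_fin.
have := measurable_fun_fubini_tonelli_F (m2 := P) h mh h0.
apply: eq_measurable_fun => s _; rewrite /fubini_F /h /=.
have -> : hit_prob A s = hit_prob A (Num.max 0 s) by rewrite /hit_prob maxA maxxx.
by rewrite hit_probE// integral_indic_comp//; exact: mM.
Qed.

(** For a frozen path of D the increments of Z are increments of M over the
    deterministic times D (t i), hence independent, with laws that depend on the
    lengths D (t i.+1) - D (t i) only.  These lengths are in turn independent. *)
Lemma subordinated_increments (n : nat) (t : nat -> R) (A : 'I_n -> set R) :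
  0 <= t 0%N -> (forall i, t i <= t i.+1) -> (forall i, measurable (A i)) ->
  (P (\bigcap_(i in [set: 'I_n]) ((fun w => Z (t i.+1) w - Z (t i) w)%R @^-1` A i)) =
   \prod_(i < n) \int[P]_w (hit_prob (A i) (D (t i.+1) w - D (t i) w))%:E)%E.
Proof.
move=> t0 tle mA.
have ti0 i : 0 <= t i by elim: i => // i /le_trans; apply.
pose h (z : process_space D * process_space M) : \bar R :=
  (\prod_(i < n) \1_(A i) (M (D (t i.+1) z.1) z.2 - M (D (t i) z.1) z.2))%:E.
have mJ i : measurable_fun setT
    (fun z : process_space D * process_space M => M (D (t i) z.1) z.2).
  apply: (measurable_process_comp (tau := D (t i) : process_space D -> R)) => //.
  - exact: levy_cadlag LM.
  - exact: measurable_process_space.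
  - by move=> u; exact: D0.
have mh : measurable_fun setT h.
  apply/measurable_EFinP; apply: measurable_prod => i _.
  have m1 : measurable_fun setT (\1_(A i) : R -> R) by exact: measurable_indic.
  have mB := measurable_funB (mJ i.+1) (mJ i).
  exact: (measurableT_comp m1 mB).
have Eprod (Y : 'I_n -> T -> R) : (forall i, measurable_fun setT (Y i)) ->
    (\int[P]_w (\prod_(i < n) \1_(A i) (Y i w))%:E =
     P (\bigcap_(i in [set: 'I_n]) (Y i @^-1` A i)))%E.
  move=> mY; under eq_integral do rewrite prod_indic.
  rewrite integral_indic ?setIT//.
  apply: fin_bigcap_measurable => [|i _]; first exact: finite_finset.
  exact: mpre.
have mZ i : measurable_fun setT (Z (t i)) by exact: measurable_subordinated.
rewrite -Eprod; last by move=> i; exact: measurable_funB.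
have h0 z : (0 <= h z)%E by rewrite lee_fin prodr_ge0.
rewrite (integral_independent_processes mM mD ind mh h0).
rewrite -(integral_prod_independent (Y := fun i w => D (t i.+1) w - D (t i) w)
  (f := fun i => hit_prob (A i))); last 4 first.
- by move=> i; apply: measurable_funB; exact: mD.
- exact: (levy_independent LD).
- by move=> i; exact: measurable_hit_prob.
- by move=> i x; exact: hit_prob01.
apply: eq_integral => w _; rewrite /h /=.
have Dle i : D (t i) w <= D (t i.+1) w by exact: ndD.
rewrite (Eprod (fun i w2 => M (D (t i.+1) w) w2 - M (D (t i) w) w2)); last first.
  by move=> i; apply: measurable_funB; apply: mM; exact: D0.
rewrite -prodEFin.
rewrite (@levy_independent _ _ _ _ _ LM n (fun i => D (t i) w) (D0 _ (ti0 _)) Dle)//.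
apply: eq_bigr => i _.
rewrite hit_probE ?subr_ge0//.
rewrite -(levy_stationary LM (s := D (t i) w))// ?subr_ge0//; last exact: D0.
by rewrite subrKC.
Qed.

Lemma subordinated_increment (s t : R) (A : set R) : 0 <= s -> s <= t ->
  measurable A ->
  (P ((fun w => Z t w - Z s w)%R @^-1` A) =
   \int[P]_w (hit_prob A (D t w - D s w))%:E)%E.
Proof.
move=> s0 st mA.
pose tm (i : nat) := if i is 0%N then s else t.
have tmle i : tm i <= tm i.+1 by case: i.
have := @subordinated_increments 1 tm (fun=> A) s0 tmle (fun=> mA).
rewrite big_ord_recl big_ord0 mule1 => <-; congr (P _).
apply/seteqP; split => w /=; first by move=> ? i _; rewrite ord1.
by move=> /(_ ord0); exact.
Qed.

(** Independence and stationarity of the increments compare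
    [subordinated_increments] with its case of a single increment.  Left limits
    exist because the paths are monotone. *)
Lemma subordinated_levy : levy_process P Z.
Proof.
split.
- exact: measurable_subordinated.
- by move=> w; rewrite /Z (levy_start LD) (levy_start LM).
- move=> w t t0; split => [|tgt0].
    have [/cvgrPdist_lt cM _] := levy_cadlag LM w (D0 w t0).
    have [/cvgrPdist_lt cD _] := levy_cadlag LD w t0.
    apply/cvgrPdist_lt => e e0; have [del /= del0 Hd] := cM e e0.
    have cDd := cD _ del0.
    near=> s.
    have ts : t < s by near: s; exact: nbhs_right_gt.
    have Dts : D t w <= D s w by apply: ndD => //; exact: ltW.
    have Dd : `|D t w - D s w| < del by near: s.
    (* D may be constant to the right of t, where the limit of M along the
       punctured neighbourhood of D t says nothing. *)
    rewrite /Z; have [->|ne] := eqVneq (D s w) (D t w); first by rewrite subrr normr0.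
    by apply: Hd => //=; rewrite lt_neqAle eq_sym ne.
  have ndZ x y : 0 <= x -> x <= y -> Z x w <= Z y w.
    by move=> x0 xy; apply: ndM; [exact: D0|exact: ndD].
  apply: nondecreasing_at_left_is_cvgr.
    near=> x => a b; rewrite !in_itv/= => /andP[xa _] _; apply: ndZ.
    by apply: le_trans (ltW xa); near: x; exact: nbhs_left_ge.
  near=> x; exists (Z t w) => _ [a /= + <-]; rewrite in_itv/= => /andP[xa at'].
  apply: ndZ; last exact: ltW.
  by apply: le_trans (ltW xa); near: x; exact: nbhs_left_ge.
- move=> n t t0 tle A mA.
  rewrite subordinated_increments//; apply: eq_bigr => i _.
  rewrite subordinated_increment//.
  by elim: (nat_of_ord i) => // j /le_trans; apply.
- move=> s t A s0 t0 mA.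
  rewrite subordinated_increment ?lerDl//.
  transitivity (P ((fun w => Z t w - Z 0 w) @^-1` A)); last first.
    congr (P _); apply/seteqP; split=> w /=;
    by rewrite /Z (levy_start LD) (levy_start LM) subr0.
  rewrite subordinated_increment//.
  under [RHS]eq_integral do rewrite (levy_start LD) subr0.
  apply: eq_law_integral => //.
  + by apply: measurable_funB; apply: mD => //; exact: addr_ge0.
  + exact: mD.
  + by move=> B mB; exact: levy_stationary.
  + by move=> x; have /andP[] := hit_prob01 x mA.
  + exact: measurable_hit_prob.
Unshelve. all: end_near. Qed.
End subordination.

(** * The transform of a Levy process from its behaviour at small times *)

(** Passing from a^n to b^n one factor at a time costs |a - b| per factor. *)
Lemma normr_exprB (K : numDomainType) (a b : K) (n : nat) :
  `|a| <= 1 -> `|b| <= 1 -> `|a ^+ n - b ^+ n| <= n%:R * `|a - b|.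
Proof.
move=> a1 b1; elim: n => [|n IH]; first by rewrite !expr0 subrr normr0 mul0r.
have -> : a ^+ n.+1 - b ^+ n.+1 = a * (a ^+ n - b ^+ n) + (a - b) * b ^+ n.
  by rewrite !exprS mulrBr mulrBl addrA subrK.
rewrite (le_trans (ler_normD _ _))// -natr1 [leRHS]mulrDl mul1r lerD//.
  by rewrite normrM (le_trans _ IH)// ler_piMl.
by rewrite normrM ler_piMr// normrX exprn_ile1.
Qed.

Section levy_transform.
Context (R : realType).

Lemma cexpD (z w : R[i]) : cexp (z + w) = cexp z * cexp w.
Proof.
case: z w => [a b] [c e]; rewrite /cexp /=.
rewrite expRD cosD sinD; apply/eqP; rewrite eq_complex /=; apply/andP; split; apply/eqP; ring.
Qed.

Lemma cexp0 : cexp (0 : R[i]) = 1.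
Proof. by rewrite /cexp /= expR0 cos0 sin0 mulr1 mulr0. Qed.

Lemma cexpX (z : R[i]) (n : nat) : cexp z ^+ n = cexp (z *+ n).
Proof.
by elim: n => [|n IH]; rewrite ?expr0 ?mulr0n ?cexp0// exprS IH mulrS cexpD.
Qed.

Lemma normc_le1 (x y : R) : (`|x +i* y| <= 1)%C = (x ^+ 2 + y ^+ 2 <= 1).
Proof.
rewrite normc_def /= -[1]/(1%:C)%C lecR -[X in _ <= X]sqrtr1 ler_sqrt//.
Qed.

Lemma normc_le_sum (x y : R) : (`|x +i* y| <= (`|x| + `|y|)%:C)%C.
Proof.
rewrite normc_def /= lecR.
rewrite -[leRHS]ger0_norm ?addr_ge0// -sqrtr_sqr ler_sqrt ?sqr_ge0//.
by rewrite sqrrD !real_normK ?num_real// -addrA lerD2l lerDr mulrn_wge0// mulr_ge0.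
Qed.

Lemma Re_le_normc (x y : R) : ((`|x|)%:C <= `|x +i* y|)%C.
Proof.
rewrite normc_def /= lecR -sqrtr_sqr ler_sqrt ?lerDl ?sqr_ge0//.
by rewrite addr_ge0 ?sqr_ge0.
Qed.

Lemma Im_le_normc (x y : R) : ((`|y|)%:C <= `|x +i* y|)%C.
Proof.
rewrite normc_def /= lecR -sqrtr_sqr ler_sqrt ?lerDr ?sqr_ge0//.
by rewrite addr_ge0 ?sqr_ge0.
Qed.

(** Real and imaginary parts of exp(- v |x| + i u x): the case v = 0 is the
    characteristic function, the case u = 0 the Laplace transform of nonnegative
    variables, and the absolute value keeps the modulus below 1 on the whole
    line. *)
Definition tcos (v u x : R) := expR (- (v * `|x|)) * cos (u * x).
Definition tsin (v u x : R) := expR (- (v * `|x|)) * sin (u * x).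

Let measurable_texp v : measurable_fun setT (fun x : R => expR (- (v * `|x|))).
Proof.
apply: continuous_measurable_fun => x.
apply: continuous_comp; last exact: continuous_expR.
by apply: continuousN; apply: continuousM; [exact: cst_continuous|exact: norm_continuous].
Qed.

Let continuous_mull (u : R) : continuous (fun x : R => u * x).
Proof. by move=> x; apply: continuousM; [exact: cst_continuous|exact: cvg_id]. Qed.

Lemma measurable_tcos v u : measurable_fun setT (tcos v u).
Proof.
apply: measurable_funM => //; apply: continuous_measurable_fun => x.
by apply: continuous_comp; [exact: continuous_mull|exact: continuous_cos].
Qed.

Lemma measurable_tsin v u : measurable_fun setT (tsin v u).
Proof.
apply: measurable_funM => //; apply: continuous_measurable_fun => x.
by apply: continuous_comp; [exact: continuous_mull|exact: continuous_sin].
Qed.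

Lemma tcos2Dtsin2 v u x : 0 <= v -> tcos v u x ^+ 2 + tsin v u x ^+ 2 <= 1.
Proof.
move=> v0; rewrite /tcos /tsin !exprMn -mulrDr cos2Dsin2 mulr1.
rewrite exprn_ile1 ?expR_ge0//.
by rewrite -expR0 ler_expR oppr_le0 mulr_ge0.
Qed.

Lemma tcos_le1 v u x : 0 <= v -> `|tcos v u x| <= 1.
Proof.
move=> v0; rewrite -(@expr_le1 _ 2)// real_normK ?num_real//; apply: le_trans (tcos2Dtsin2 u x v0).
by rewrite lerDl sqr_ge0.
Qed.

Lemma tsin_le1 v u x : 0 <= v -> `|tsin v u x| <= 1.
Proof.
move=> v0; rewrite -(@expr_le1 _ 2)// real_normK ?num_real//; apply: le_trans (tcos2Dtsin2 u x v0).
by rewrite lerDr sqr_ge0.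
Qed.

Let derive_at_right (f : R -> R) (a : R) : is_derive (0 : R) 1 f a ->
  (f h - f 0) / h @[h --> 0^'+] --> a.
Proof.
move=> [df fa]; have : (fun h => h^-1 *: ((f \o shift 0) (h *: 1) - f 0)) @ 0^' --> a.
  by rewrite -fa; exact: df.
move=> /cvg_dnbhs_at_right; apply: cvg_trans; apply: near_eq_cvg.
by near=> h; rewrite /= addr0 /GRing.scale/= mulr1 mulrC.
Unshelve. all: end_near. Qed.

Lemma exp_cos_derive (a b : R) :
  (expR (h * a) * cos (h * b) - 1) / h @[h --> 0^'+] --> a.
Proof.
have D : is_derive (0 : R) 1 (fun h : R => expR (h * a) * cos (h * b)) a.
  apply: is_derive_eq; rewrite !mul0r expR0 cos0 sin0 /GRing.scale /=; ring.
by have := derive_at_right D; rewrite !mul0r expR0 cos0 mulr1.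
Qed.

Lemma exp_sin_derive (a b : R) :
  (expR (h * a) * sin (h * b)) / h @[h --> 0^'+] --> b.
Proof.
have D : is_derive (0 : R) 1 (fun h : R => expR (h * a) * sin (h * b)) b.
  apply: is_derive_eq; rewrite !mul0r expR0 cos0 sin0 /GRing.scale /=; ring.
have := derive_at_right D; rewrite !mul0r expR0 sin0 mulr0.
by under eq_fun do rewrite subr0.
Qed.

Context (d : measure_display)
  (T : measurableType d) (P : probability T R) (X : R -> T -> R).
Hypotheses (LX : levy_process P X) (ndX : nondecreasing_paths X).
Variables (v u a b : R).
Hypothesis v0 : 0 <= v.
Hypothesis Ha : (\int[P]_w tcos v u (X h w) - 1) / h @[h --> 0^'+] --> a.
Hypothesis Hb : (\int[P]_w tsin v u (X h w)) / h @[h --> 0^'+] --> b.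

Let phi t : R[i] := ((\int[P]_w tcos v u (X t w)) +i* (\int[P]_w tsin v u (X t w)))%C.

Let mX t : 0 <= t -> measurable_fun setT (X t). Proof. exact: (levy_measurable LX). Qed.

Let X_ge0 t w : 0 <= t -> 0 <= X t w.
Proof. by move=> t0; have := ndX w (lexx 0) t0; rewrite (levy_start LX). Qed.

Let iX (f g : R -> R) (Y Y' : T -> R) : measurable_fun setT f -> measurable_fun setT g ->
  measurable_fun setT Y -> measurable_fun setT Y' ->
  (forall x, `|f x| <= 1) -> (forall x, `|g x| <= 1) ->
  P.-integrable setT (EFin \o (fun w => f (Y w) * g (Y' w))).
Proof.
move=> mf mg mY mY' f1 g1; apply: (@bounded_integrable _ _ _ _ _ 1).
- exact: probability_lty.
- by apply: measurable_funM; [exact: (measurableT_comp mf)|exact: (measurableT_comp mg)].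
- by move=> w; rewrite normrM mulr_ile1.
Qed.

Let iX1 (f : R -> R) (Y : T -> R) : measurable_fun setT f ->
  measurable_fun setT Y -> (forall x, `|f x| <= 1) ->
  P.-integrable setT (EFin \o (fun w => f (Y w))).
Proof.
move=> mf mY f1; apply: (@bounded_integrable _ _ _ _ _ 1) => //.
- exact: probability_lty.
- exact: (measurableT_comp mf).
Qed.

Let mc := measurable_tcos v u.
Let ms := measurable_tsin v u.
Let c1 x := tcos_le1 u x v0.
Let s1 x := tsin_le1 u x v0.

(** The exponential turns X (s + t) = X s + (X (s + t) - X s) into a product of
    functions of two independent increments. *)
Let phiD s t : 0 <= s -> 0 <= t -> phi (s + t) = phi s * phi t.
Proof.
move=> s0 t0.
have st : s <= s + t by rewrite lerDl.
have Y0 w : 0 <= X (s + t) w - X s w by rewrite subr_ge0; exact: ndX.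
have mY : measurable_fun setT (fun w => X (s + t) w - X s w).
  by apply: measurable_funB; apply: mX => //; exact: addr_ge0.
have e w : expR (- (v * `|X (s + t) w|)) =
    expR (- (v * `|X s w|)) * expR (- (v * `|X (s + t) w - X s w|)).
  rewrite -expRD (ger0_norm (Y0 w)) (ger0_norm (X_ge0 w s0)).
  by rewrite (ger0_norm (X_ge0 w (addr_ge0 s0 t0))); congr expR; ring.
have xe w : u * X (s + t) w = u * X s w + u * (X (s + t) w - X s w) by ring.
apply/eqP; rewrite eq_complex /=; apply/andP; split; apply/eqP.
- transitivity (\int[P]_w (tcos v u (X s w) * tcos v u (X (s + t) w - X s w) -
                           tsin v u (X s w) * tsin v u (X (s + t) w - X s w))).
    apply: eq_Rintegral => w _; rewrite /tcos /tsin e xe cosD; ring.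
  by rewrite RintegralB ?levy_pair_Rintegral//; apply: iX => //; exact: mX.
- transitivity (\int[P]_w (tcos v u (X s w) * tsin v u (X (s + t) w - X s w) +
                           tsin v u (X s w) * tcos v u (X (s + t) w - X s w))).
    apply: eq_Rintegral => w _; rewrite /tcos /tsin e xe sinD; ring.
  by rewrite RintegralD ?levy_pair_Rintegral//; apply: iX => //; exact: mX.
Qed.

(** With phi = A + i B, the number A^2 + B^2 is the expectation of
    A tcos + B tsin, which is pointwise at most (A^2 + B^2 + 1) / 2. *)
Let phi_le1 t : 0 <= t -> `|phi t| <= 1.
Proof.
move=> t0; rewrite normc_le1.
set A := Rintegral _ _ _; set B := Rintegral _ _ _.
have ic := iX1 mc (mX t0) c1; have is_ := iX1 ms (mX t0) s1.
have iAc : P.-integrable setT (EFin \o (fun w => A * tcos v u (X t w))).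
  exact: (integrableZl measurableT A ic).
have iBs : P.-integrable setT (EFin \o (fun w => B * tsin v u (X t w))).
  exact: (integrableZl measurableT B is_).
have AB : A ^+ 2 + B ^+ 2 = \int[P]_w (A * tcos v u (X t w) + B * tsin v u (X t w)).
  by rewrite RintegralD// !RintegralZl// !expr2.
suff : A ^+ 2 + B ^+ 2 <= (A ^+ 2 + B ^+ 2 + 1) / 2 by lra.
rewrite {1}AB; apply: (@le_trans _ _ (\int[P]_w ((A ^+ 2 + B ^+ 2 + 1) / 2))).
  apply: le_Rintegral => //.
  - rewrite (_ : _ \o _ = (EFin \o (fun w => A * tcos v u (X t w))) \+
      (EFin \o (fun w => B * tsin v u (X t w))))//.
    exact: integrableD.
  - exact: finite_measure_integrable_cst.
  - move=> w _; have := tcos2Dtsin2 u (X t w) v0.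
    have := sqr_ge0 (A - tcos v u (X t w)); have := sqr_ge0 (B - tsin v u (X t w)).
    nra.
by rewrite Rintegral_cst// [X in fine X]probability_setT mulr1.
Qed.

(** The real part of phi is at most 1, so its slope at 0 is not positive; this
    keeps exp(h (a + i b)) in the unit disc. *)
Let a_le0 : a <= 0.
Proof.
apply: (cvgr_to_le Ha); near=> h.
have h0 : 0 < h by near: h; exact: nbhs_right_gt.
rewrite pmulr_lle0 ?invr_gt0// subr_le0.
have := phi_le1 (ltW h0); rewrite normc_le1; set A := Rintegral _ _ _.
by have := sqr_ge0 (A - 1); set B := Rintegral _ _ _; have := sqr_ge0 B; nra.
Unshelve. all: end_near. Qed.

Let phiX t n : 0 <= t -> phi t ^+ n.+1 = phi (n.+1%:R * t).
Proof.
move=> t0; elim: n => [|n IH]; first by rewrite expr1 mul1r.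
rewrite exprS IH -phiD// ?mulr_ge0//; congr phi; rewrite -[n.+2%:R]natr1; ring.
Qed.

(** Both phi_t and E_t = exp(t (a + i b)) are n-th powers of their values at t/n,
    so by [normr_exprB] they differ by at most n |phi_(t/n) - E_(t/n)|, which
    tends to 0 because the two functions have the same slope at 0. *)
Lemma levy_transform t : 0 <= t ->
  \int[P]_w tcos v u (X t w) = expR (t * a) * cos (t * b) /\
  \int[P]_w tsin v u (X t w) = expR (t * a) * sin (t * b).
Proof.
rewrite le_eqVlt => /predU1P[<-|t0].
  rewrite !mul0r expR0 cos0 sin0 mulr1 mulr0.
  under eq_Rintegral do rewrite (levy_start LX) /tcos normr0 !mulr0 oppr0 expR0 cos0 mulr1.
  under [X in _ /\ X = _]eq_Rintegral do rewrite (levy_start LX) /tsin normr0 !mulr0 sin0 mulr0.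
  rewrite !Rintegral_cst// [X in fine X]probability_setT.
  by rewrite mulr1 mul0r.
pose E h := cexp ((h * a) +i* (h * b))%C.
pose dc h := \int[P]_w tcos v u (X h w) - expR (h * a) * cos (h * b).
pose ds h := \int[P]_w tsin v u (X h w) - expR (h * a) * sin (h * b).
pose G h := `|dc h / h| + `|ds h / h|.
have G0 : G h @[h --> 0^'+] --> 0.
  have Hc : dc h / h @[h --> 0^'+] --> (0 : R).
    have Hd := cvgB Ha (@exp_cos_derive a b); rewrite subrr in Hd.
    rewrite (_ : (fun h => dc h / h) = (fun h => (\int[P]_w tcos v u (X h w) - 1) / h -
      (expR (h * a) * cos (h * b) - 1) / h)); first exact: Hd.
    by apply/funext => h; rewrite /dc -mulrBl; congr (_ / _); ring.
  have Hs : ds h / h @[h --> 0^'+] --> (0 : R).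
    have Hd := cvgB Hb (@exp_sin_derive a b); rewrite subrr in Hd.
    rewrite (_ : (fun h => ds h / h) = (fun h => (\int[P]_w tsin v u (X h w)) / h -
      (expR (h * a) * sin (h * b)) / h)); first exact: Hd.
    by apply/funext => h; rewrite /ds -mulrBl.
  have := cvgD (cvg_norm Hc) (cvg_norm Hs); rewrite normr0 addr0; exact.
have bound n : `|phi t - E t| <= (t * G (t / n.+1%:R))%:C%C.
  set h := t / n.+1%:R.
  have h0 : 0 < h by rewrite divr_gt0.
  have th : t = n.+1%:R * h by rewrite mulrC divfK.
  have phiE : phi t = phi h ^+ n.+1 by rewrite phiX ?ltW// -th.
  have EE : E t = E h ^+ n.+1.
    rewrite /E cexpX; congr cexp; rewrite {1 2}th -mulr_natl.
    by apply/eqP; rewrite eq_complex /=; apply/andP; split; apply/eqP; rewrite ?raddfMn /=; ring.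
  have E1 : `|E h| <= 1.
    rewrite normc_le1 !exprMn -mulrDr cos2Dsin2 mulr1 exprn_ile1 ?expR_ge0//.
    by rewrite -expR0 ler_expR mulr_ge0_le0// ltW.
  rewrite phiE EE; apply: le_trans (normr_exprB _ (phi_le1 (ltW h0)) E1) _.
  apply: le_trans (ler_wpM2l _ (normc_le_sum (dc h) (ds h))) _ => //.
  rewrite -(rmorph_nat (real_complex R)) -rmorphM lecR /G.
  rewrite !normrM !(gtr0_norm (_ : 0 < h^-1)) ?invr_gt0//.
  rewrite -mulrDl {1}th.
  rewrite [leRHS](_ : _ = n.+1%:R * (`|dc h| + `|ds h|))//.
  by clearbody h; field; rewrite gt_eqF.
have lim0 : t * G (t / n.+1%:R) @[n --> \oo] --> (0 : R).
  rewrite -(mulr0 t); apply: cvgMr.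
  move/cvg_at_rightP : G0; apply; split; first by move=> n; rewrite divr_gt0.
  rewrite -(mulr0 t); apply: cvgMr; exact: cvg_harmonic.
have part0 (x : R) : (forall n, `|x| <= t * G (t / n.+1%:R)) -> x = 0.
  move=> xG; apply/eqP; rewrite -normr_le0.
  by apply: (cvgr_to_ge lim0); apply: nearW.
have dE : phi t - E t = (dc t +i* ds t)%C by [].
split; apply/subr0_eq/part0 => n; rewrite -lecR; apply: le_trans (bound n); rewrite dE.
  exact: Re_le_normc.
exact: Im_le_normc.
Unshelve. all: end_near. Qed.
End levy_transform.

(** For nondecreasing processes [nu g] is the integral of [g] against the Levy
    measure; keeping [nu] a mere functional also covers the finite sum given by
    the rates of a counting process. *)
Definition small_time_limit (R : realType) (d : measure_display)
    (T : measurableType d) (P : probability T R) (X : R -> T -> R)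
    (nu : (R -> R) -> R) : Prop :=
  forall (g : R -> R) (C : R),
    measurable_fun setT g -> (forall x, `|g x| <= C) -> g 0 = 0 ->
  (\int[P]_w g (X h w)) / h @[h --> 0^'+] --> nu g.

Lemma levy_transform_small_time (R : realType) (d : measure_display)
    (T : measurableType d) (P : probability T R) (X : R -> T -> R)
    (nu : (R -> R) -> R) (v u t : R) :
  levy_process P X -> nondecreasing_paths X -> small_time_limit P X nu ->
  0 <= v -> 0 <= t ->
  let a := nu (fun x => tcos v u x - 1) in let b := nu (tsin v u) in
  \int[P]_w tcos v u (X t w) = expR (t * a) * cos (t * b) /\
  \int[P]_w tsin v u (X t w) = expR (t * a) * sin (t * b).
Proof.
move=> LX ndX small v0 t0 a b.
have g0 : tcos v u 0 - 1 = 0.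
  by rewrite /tcos normr0 !mulr0 oppr0 expR0 cos0 mulr1 subrr.
have mg : measurable_fun setT (fun x => tcos v u x - 1).
  by apply: measurable_funB => //; exact: measurable_tcos.
have g2 x : `|tcos v u x - 1| <= 2.
  rewrite (le_trans (ler_normB _ _))// normr1 -[leRHS]/(1 + 1) lerD2r.
  exact: tcos_le1.
have Ha : (\int[P]_w tcos v u (X h w) - 1) / h @[h --> 0^'+] --> a.
  apply: cvg_trans (small _ _ mg g2 g0); apply: near_eq_cvg; near=> h.
  have h0 : 0 < h by near: h; exact: nbhs_right_gt.
  rewrite RintegralB//.
  - by rewrite Rintegral_cst// [X in fine X]probability_setT mulr1.
  - apply: (@bounded_integrable _ _ _ _ _ 1) => //; first exact: probability_lty.
      exact: (measurableT_comp (measurable_tcos v u) (levy_measurable LX (ltW h0))).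
    by move=> w; exact: tcos_le1.
  - exact: finite_measure_integrable_cst.
have Hb : (\int[P]_w tsin v u (X h w)) / h @[h --> 0^'+] --> b.
  apply: (small _ 1); [exact: measurable_tsin|by move=> x; exact: tsin_le1|].
  by rewrite /tsin mulr0 sin0 mulr0.
exact: (levy_transform LX ndX v0 Ha Hb t0).
Unshelve. all: end_near. Qed.

(** * Positive functionals on functions of a natural variable *)

Section natural_positive.
Context (R : realType).

Definition bounded_measurable (g : R -> R) :=
  measurable_fun setT g /\ exists C, forall x, `|g x| <= C.

Lemma bounded_measurableD f g : bounded_measurable f -> bounded_measurable g ->
  bounded_measurable (fun x => f x + g x).
Proof.
move=> [mf [C fC]] [mg [C' gC']]; split; first exact: measurable_funD.
by exists (C + C') => x; rewrite (le_trans (ler_normD _ _))// lerD.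
Qed.

Lemma bounded_measurableZ c f : bounded_measurable f ->
  bounded_measurable (fun x => c * f x).
Proof.
move=> [mf [C fC]]; split; first exact: measurable_funM.
by exists (`|c| * C) => x; rewrite normrM ler_wpM2l.
Qed.

Lemma bounded_measurableB f g : bounded_measurable f -> bounded_measurable g ->
  bounded_measurable (fun x => f x - g x).
Proof.
move=> bf /(bounded_measurableZ (-1)) /(bounded_measurableD bf).
by under eq_fun do rewrite mulN1r.
Qed.

Lemma bounded_measurable_sum N (f : nat -> R -> R) :
  (forall i, bounded_measurable (f i)) ->
  bounded_measurable (fun x => \sum_(i < N) f i x).
Proof.
move=> bf; elim: N => [|N IH].
  under eq_fun do rewrite big_ord0; split; first exact: measurable_cst.
  by exists 0 => x; rewrite normr0.
by under eq_fun do rewrite big_ord_recr/=; exact: bounded_measurableD.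
Qed.

Lemma bounded_measurable_indic (A : set R) : measurable A ->
  bounded_measurable (\1_A : R -> R).
Proof.
move=> mA; split; first exact: measurable_indic.
by exists 1 => x; rewrite indicE ger0_norm; case: (_ \in _).
Qed.

(** What g |-> E g(X) / h, for X with natural values, and the integral against a
    finite measure on the naturals have in common: linearity, and monotonicity
    tested at the naturals only. *)
Definition natural_positive (J : (R -> R) -> R) : Prop :=
  [/\ forall f g, bounded_measurable f -> bounded_measurable g ->
        J (fun x => f x + g x) = J f + J g,
      forall c f, bounded_measurable f -> J (fun x => c * f x) = c * J f &
      forall f g, bounded_measurable f -> bounded_measurable g ->
        (forall n : nat, f n%:R <= g n%:R) -> J f <= J g ].

Definition beyond (N : nat) : R -> R := \1_(`]N%:R, +oo[%classic).
Definition at_nat (N : nat) : R -> R := \1_([set N%:R]).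

Lemma bounded_measurable_beyond N : bounded_measurable (beyond N).
Proof. by apply: bounded_measurable_indic; exact: measurable_itv. Qed.

Lemma bounded_measurable_at_nat N : bounded_measurable (at_nat N).
Proof. exact: bounded_measurable_indic. Qed.

Lemma beyondE N n : beyond N n%:R = (N < n)%N%:R.
Proof.
rewrite /beyond indicE; congr (nat_of_bool _)%:R; apply/idP/idP.
  by move=> /set_mem; rewrite /= in_itv/= andbT ltr_nat.
by move=> Nn; apply/mem_set; rewrite /= in_itv/= andbT ltr_nat.
Qed.

Lemma at_natE N n : at_nat N n%:R = (n == N)%:R.
Proof.
rewrite /at_nat indicE; congr (nat_of_bool _)%:R; apply/idP/eqP.
  by move=> /set_mem /= /eqP; rewrite eqr_nat => /eqP.
by move=> ->; apply/mem_set.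
Qed.

Section functional.
Variables (J : (R -> R) -> R).
Hypothesis JP : natural_positive J.

Lemma natural_positive_sum N (f : nat -> R -> R) :
  (forall i, bounded_measurable (f i)) ->
  J (fun x => \sum_(i < N) f i x) = \sum_(i < N) J (f i).
Proof.
have [JD JZ _] := JP.
move=> bf; elim: N => [|N IH].
  rewrite big_ord0; under eq_fun do rewrite big_ord0.
  transitivity (J (fun x => 0 * f 0%N x)); last by rewrite JZ// mul0r.
  by congr J; apply/funext => x; rewrite mul0r.
rewrite big_ord_recr/= -IH; under eq_fun do rewrite big_ord_recr/=.
by apply: JD => //; exact: bounded_measurable_sum.
Qed.

Lemma natural_positiveB f g : bounded_measurable f -> bounded_measurable g ->
  J (fun x => f x - g x) = J f - J g.
Proof.
have [JD JZ _] := JP => bf bg.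
rewrite -[X in _ + X]mulN1r -JZ// -JD//; last exact: bounded_measurableZ.
by congr J; apply/funext => x; rewrite mulN1r.
Qed.

Lemma natural_positive_ext f g : bounded_measurable f -> bounded_measurable g ->
  (forall n : nat, f n%:R = g n%:R) -> J f = J g.
Proof.
have [_ _ JM] := JP => bf bg fg; apply/eqP; rewrite eq_le.
by apply/andP; split; apply: JM => // n; rewrite fg.
Qed.

(** At a natural n <= N the function [g] agrees with its expansion over 1, ..., N
    (0 contributes nothing as g 0 = 0), and beyond N it is at most C. *)
Lemma natural_positive_trunc (g : R -> R) (C : R) (N : nat) :
  measurable_fun setT g -> (forall x, `|g x| <= C) -> g 0 = 0 ->
  `|J g - \sum_(j < N) g j.+1%:R * J (at_nat j.+1)| <= C * J (beyond N).
Proof.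
have [JD JZ JM] := JP => mg gC g0.
have bg : bounded_measurable g by split => //; exists C.
pose f (j : nat) x := g j.+1%:R * at_nat j.+1 x.
have bf j : bounded_measurable (f j).
  exact/bounded_measurableZ/bounded_measurable_at_nat.
have bs := bounded_measurable_sum N bf.
have -> : \sum_(j < N) g j.+1%:R * J (at_nat j.+1) = J (fun x => \sum_(j < N) f j x).
  rewrite natural_positive_sum//; apply: eq_bigr => j _.
  by rewrite JZ//; exact: bounded_measurable_at_nat.
have be := bounded_measurable_beyond N.
rewrite -natural_positiveB// -JZ// ler_norml -mulN1r -JZ; last exact: bounded_measurableZ.
have key n : `|g n%:R - \sum_(j < N) f j n%:R| <= C * beyond N n%:R.
  rewrite beyondE; have [nN|Nn] := ltnP N n.
    rewrite big1 ?subr0 ?mulr1// => j _; rewrite /f at_natE.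
    by rewrite gtn_eqF ?mulr0//; exact: leq_ltn_trans (ltn_ord j) nN.
  rewrite mulr0; case: n Nn => [_|n nN].
    by rewrite g0 big1 ?subr0 ?normr0// => j _; rewrite /f at_natE mulr0.
  rewrite (bigD1 (Ordinal nN))//= big1 ?addr0.
    by rewrite /f at_natE eqxx mulr1 subrr normr0.
  move=> j jn; rewrite /f at_natE eqSS eq_sym.
  by rewrite (negbTE (_ : (j : nat) != n)) ?mulr0.
apply/andP; split; apply: JM.
- by do 2 apply: bounded_measurableZ.
- exact: bounded_measurableB.
- by move=> n; have := key n; rewrite ler_norml mulN1r => /andP[].
- exact: bounded_measurableB.
- exact: bounded_measurableZ.
- by move=> n; have := key n; rewrite ler_norml => /andP[].
Qed.
End functional.

Lemma natural_positive_law (d : measure_display) (T : measurableType d)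
    (P : probability T R) (X : T -> R) (h : R) :
  measurable_fun setT X -> (forall w, exists n : nat, X w = n%:R) -> 0 < h ->
  natural_positive (fun g => (\int[P]_w g (X w)) / h).
Proof.
move=> mX Xn h0.
have int g : bounded_measurable g -> P.-integrable setT (EFin \o (fun w => g (X w))).
  move=> [mg [C gC]]; apply: (@bounded_integrable _ _ _ _ _ C) => //.
    exact: probability_lty.
  exact: (measurableT_comp mg mX).
split.
- by move=> f g bf bg; rewrite RintegralD// ?mulrDl//; exact: int.
- by move=> c f bf; rewrite RintegralZl ?mulrA//; exact: int.
- move=> f g bf bg fg; rewrite ler_pM2r ?invr_gt0// le_Rintegral//; [exact: int|exact: int|].
  by move=> w _; have [n ->] := Xn w.
Qed.

Lemma Rintegral_law_indic (d : measure_display) (T : measurableType d)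
    (P : probability T R) (X : T -> R) (A : set R) :
  measurable_fun setT X -> measurable A ->
  \int[P]_w \1_A (X w) = fine (P (X @^-1` A)).
Proof.
by move=> mX mA; rewrite /Rintegral integral_indic_comp.
Qed.

(** Off a null set of non-naturals f is below g, so f may be replaced by
    min(f, g), which is below g everywhere. *)
Lemma natural_positive_measure (Pi : {measure set (measurableTypeR R) -> \bar R}) :
  (Pi setT < +oo)%E -> Pi (~` range (fun n : nat => n%:R : R)) = 0%E ->
  natural_positive (fun g => \int[Pi]_x g x).
Proof.
move=> Pfin PN.
have int g : bounded_measurable g -> Pi.-integrable setT (EFin \o g).
  by move=> [mg [C gC]]; apply: (@bounded_integrable _ _ _ _ _ C).
split.
- by move=> f g bf bg; rewrite RintegralD//; exact: int.
- by move=> c f bf; rewrite RintegralZl//; exact: int.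
- move=> f g bf bg fg.
  have bm : bounded_measurable (fun x => Num.min (f x) (g x)).
    case: bf bg => [mf [C fC]] [mg [C' gC']]; split; first exact: measurable_minr.
    by exists (Num.max C C') => x; rewrite le_max /Num.min; case: ifP; rewrite ?fC ?gC' ?orbT.
  have -> : \int[Pi]_x f x = \int[Pi]_x Num.min (f x) (g x).
    rewrite /Rintegral; congr fine; apply: ae_eq_integral => //.
    + by apply/measurable_EFinP; case: bf.
    + by apply/measurable_EFinP; case: bm.
    + exists (~` range (fun n : nat => n%:R : R)); split => //.
        apply: measurableC; apply: countable_measurable => //.
        exact: (sub_countable (card_image_le _ _)).
      move=> x /= fg_x [n _ nx]; apply: fg_x => _; rewrite -nx.
      by rewrite min_l.
  by apply: le_Rintegral => //; [exact: int|exact: int|move=> x _; rewrite ge_min lexx orbT].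
Qed.

End natural_positive.

(** * The generalized counting process at small times *)

Section gcp.
Context (R : realType) (d : measure_display) (T : measurableType d)
  (P : probability T R) (k : nat) (lambda : 'I_k -> R) (M : R -> T -> R).
Hypothesis GM : generalized_counting_process P lambda M.

Let LM := gcp_levy GM.
Let ndM := gcp_nondecreasing GM.
Let mM t : 0 <= t -> measurable_fun setT (M t). Proof. exact: (levy_measurable LM). Qed.

Definition gcp_rates (g : R -> R) : R := \sum_(j < k) lambda j * g j.+1%:R.

(** Truncating [g] at k leaves the probabilities of the k jump sizes, whose
    quotients by h tend to the rates, and an error of at most C P(M_h > k), which
    is o(h). *)
Lemma gcp_small_time : small_time_limit P M gcp_rates.
Proof.
move=> g C mg gC g0; rewrite /gcp_rates.
pose A h := \sum_(j < k) g j.+1%:R * (fine (P [set w | M h w = j.+1%:R]) / h).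
pose B h := fine (P [set w | k%:R < M h w]) / h.
have cA : A h @[h --> 0^'+] --> \sum_(j < k) lambda j * g j.+1%:R.
  rewrite /A; under eq_bigr do rewrite mulrC.
  apply: (cvg_big (op := +%R)) => [|j _]; first exact: add_continuous.
  by apply: cvgM; [exact: cvg_cst|exact: (gcp_rate GM)].
have cB : C * B h @[h --> 0^'+] --> 0.
  rewrite -[X in _ --> X](mulr0 C).
  by apply: cvgM; [exact: cvg_cst|exact: (gcp_no_larger_jump GM)].
apply/cvgrPdist_lt => e e0.
have e20 : 0 < e / 2 by rewrite divr_gt0.
move/cvgrPdist_lt : cA => /(_ _ e20) cA; move/cvgrPdist_lt : cB => /(_ _ e20) cB.
near=> h.
have h0 : 0 < h by near: h; exact: nbhs_right_gt.
have JP := natural_positive_law P (mM (ltW h0)) (fun w => gcp_nat GM w (ltW h0)) h0.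
have := natural_positive_trunc JP k mg gC g0.
have -> : \int[P]_w beyond k (M h w) / h = B h.
  rewrite /B /beyond (Rintegral_law_indic P (mM (ltW h0)))//; congr (fine (P _) / _).
  by apply/seteqP; split => w /=; rewrite in_itv/= andbT.
have -> : \sum_(j < k) g j.+1%:R * (\int[P]_w at_nat j.+1 (M h w) / h) = A h.
  apply: eq_bigr => j _; rewrite /at_nat (Rintegral_law_indic P (mM (ltW h0)))//.
move=> JA.
have hA : `|\sum_(j < k) lambda j * g j.+1%:R - A h| < e / 2 by near: h.
have hB : `|0 - C * B h| < e / 2 by near: h.
rewrite sub0r normrN in hB.
rewrite -(subrKA (A h)) (le_lt_trans (ler_normD _ _))// [ltRHS](splitr e) ltrD//.
by rewrite distrC (le_lt_trans JA)// (le_lt_trans (ler_norm _)).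
Unshelve. all: end_near. Qed.

Definition laplace_exponent (v : R) : R :=
  \sum_(j < k) lambda j * (1 - expR (- (v * j.+1%:R))).

Lemma gcp_ge0 t w : 0 <= t -> 0 <= M t w.
Proof. by move=> t0; have [n ->] := gcp_nat GM w t0. Qed.

Lemma gcp_laplace v t : 0 <= v -> 0 <= t ->
  \int[P]_w expR (- (v * M t w)) = expR (- (t * laplace_exponent v)).
Proof.
move=> v0 t0.
have [+ _] := levy_transform_small_time 0 LM ndM gcp_small_time v0 t0.
have -> : gcp_rates (fun x => tcos v 0 x - 1) = - laplace_exponent v.
  rewrite /gcp_rates -sumrN; apply: eq_bigr => j _.
  by rewrite /tcos mul0r cos0 mulr1 ger0_norm// -[RHS]mulrN opprB.
have -> : gcp_rates (tsin v 0) = 0.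
  by apply: big1 => j _; rewrite /tsin mul0r sin0 !mulr0.
rewrite mulr0 cos0 mulr1 mulrN => <-; apply: eq_Rintegral => w _.
by rewrite /tcos mul0r cos0 mulr1 ger0_norm// gcp_ge0.
Qed.

End gcp.

(** Averaging over M at the frozen time D_t evaluates the Laplace transform of
    D_t at the exponent of M, which is positive and thus in the range where that
    transform is given. *)
Lemma subordinated_laplace (R : realType) (d : measure_display) (T : measurableType d)
  (P : probability T R) (k : nat) (lambda : 'I_k -> R) (theta eta : R)
  (D M : R -> T -> R) (v t : R) :
  tempered_stable_subordinator P eta theta D ->
  generalized_counting_process P lambda M -> independent_processes P M D ->
  (1 <= k)%N -> (forall j, 0 < lambda j) -> 0 < v -> 0 <= t ->
  \int[P]_w expR (- (v * M (D t w) w)) =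
  expR (- (t * ((eta + laplace_exponent lambda v) `^ theta - eta `^ theta))).
Proof.
move=> HD GM ind k1 lambda0 v0 t0.
have LD := subordinator_levy (tss_subordinator HD).
have ndD := subordinator_nondecreasing (tss_subordinator HD).
have LM := gcp_levy GM; have ndM := gcp_nondecreasing GM.
have D0 w := subordinator_ge0 LD ndD w t0.
have L0 : 0 < laplace_exponent lambda v.
  rewrite /laplace_exponent; case: k k1 lambda lambda0 GM => // k' _ l l0 _.
  rewrite big_ord_recl ltr_pwDl//.
    rewrite mulr_gt0// subr_gt0 -[ltRHS]expR0 ltr_expR oppr_lt0 mulr_gt0//.
  apply: sumr_ge0 => j _; rewrite mulr_ge0 ?ltW//.
  by rewrite subr_gt0 -[ltRHS]expR0 ltr_expR oppr_lt0 mulr_gt0.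
rewrite -(tss_laplace HD L0 t0) /Rintegral; congr fine.
pose h (z : process_space D * process_space M) : \bar R :=
  (expR (- (v * M (D t z.1) z.2)))%:E.
have mh : measurable_fun setT h.
  apply/measurable_EFinP; apply: (measurableT_comp (@measurable_expR R)).
  apply: (measurableT_comp (@oppr_measurable R setT)).
  apply: measurable_funM => //.
  apply: (measurable_process_comp (tau := D t : process_space D -> R)) => //.
  - exact: levy_cadlag LM.
  - exact: measurable_process_space.
have h0 z : (0 <= h z)%E by rewrite lee_fin expR_ge0.
rewrite (integral_independent_processes (levy_measurable LM) (levy_measurable LD) ind mh h0).
apply: eq_integral => w _; rewrite /h /=.
rewrite mulrC -(gcp_laplace GM (ltW v0) (D0 w)).
rewrite /Rintegral fineK//; apply: integrable_fin_num => //.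
apply: (@bounded_integrable _ _ _ _ _ 1) => //; first exact: probability_lty.
  apply: (measurableT_comp (@measurable_expR R)).
  apply: (measurableT_comp (@oppr_measurable R setT)).
  by apply: measurable_funM => //; exact: levy_measurable LM _ (D0 w).
move=> w'; rewrite ger0_norm ?expR_ge0// -[leRHS]expR0 ler_expR oppr_le0.
by rewrite mulr_ge0 ?(ltW v0)// (gcp_ge0 GM).
Qed.

(** * From Laplace transforms to bounded functions *)

Section laplace_continuity.
Context (R : realType).

Definition one_sub_exp (v x : R) : R := 1 - expR (- (v * `|x|)).

Lemma bounded_measurable_one_sub_exp v : 0 <= v -> bounded_measurable (one_sub_exp v).
Proof.
move=> v0; have -> : one_sub_exp v = fun x => 1 - tcos v 0 x.
  by apply/funext => x; rewrite /one_sub_exp /tcos mul0r cos0 mulr1.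
split; first by apply: measurable_funB => //; exact: measurable_tcos.
exists 2 => x; rewrite (le_trans (ler_normB _ _))// normr1 -[leRHS]/(1 + 1) lerD2l.
exact: tcos_le1.
Qed.

Let geom (q : R) (n N : nat) :
  \sum_(m < N) ((1 - q) * q ^+ m) * (m < n)%N%:R = 1 - q ^+ minn n N.
Proof.
elim: N => [|N IH]; first by rewrite big_ord0 minn0 expr0 subrr.
rewrite big_ord_recr/= IH; have [nN|Nn] := leqP n N.
  by rewrite mulr0 addr0 (minn_idPl (leqW nN)).
rewrite mulr1 (minn_idPr Nn) exprS; ring.
Qed.

Variables (J : R -> (R -> R) -> R) (nu : (R -> R) -> R).
Hypothesis JP : forall h, 0 < h -> natural_positive (J h).
Hypothesis nuP : natural_positive nu.
Hypothesis Jlaplace : forall v, 0 < v ->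
  J h (one_sub_exp v) @[h --> 0^'+] --> nu (one_sub_exp v).

(** Write q = e^(-v).  At the naturals, 1 - e^(-v n) is the sum over m < n of
    (1 - q) q^m, that is, a combination of the tail indicators [beyond m].
    Removing the terms with m < N, whose limits are known by induction, leaves a
    function U equal to 0 up to N and lying between (1 - q) q^N and q^N beyond N.
    So U / q^N is [beyond N] up to a factor 1 - q, and q may be taken as small as
    needed. *)
Lemma laplace_cvg_beyond N : J h (@beyond R N) @[h --> 0^'+] --> nu (@beyond R N).
Proof.
elim/ltn_ind: N => N IH.
have bb m := bounded_measurable_beyond R m.
set E := nu (@beyond R N).
have E0 : 0 <= E.
  have [_ nuZ nuM] := nuP.
  rewrite -(mul0r (nu (@beyond R N))) -nuZ//; apply: nuM => //.
    exact: bounded_measurableZ.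
  by move=> n; rewrite mul0r beyondE.
apply/cvgrPdist_lt => e e0.
have Ee : 0 < E + e by rewrite ltr_wpDl.
(* The error made on the limit is q (E + e), which has to be e / 2. *)
pose q := e / (2 * (E + e)).
have q0 : 0 < q by rewrite divr_gt0// mulr_gt0.
have qE : q * (E + e) = e / 2 by rewrite /q; field; rewrite gt_eqF.
have q1 : q < 1 by rewrite /q ltr_pdivrMr ?mulr_gt0// mul1r; lra.
have qN0 : 0 < q ^+ N by rewrite exprn_gt0.
pose v := - ln q.
have v0 : 0 < v by rewrite oppr_gt0 ln_lt0// q0.
have wv n : one_sub_exp v n%:R = 1 - q ^+ n.
  rewrite /one_sub_exp ger0_norm// /v mulNr opprK mulrC expRM_natl lnK ?posrE//.
have bw := bounded_measurable_one_sub_exp (ltW v0).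
pose f (m : nat) (x : R) := ((1 - q) * q ^+ m) * beyond m x.
have bf m : bounded_measurable (f m) by exact/bounded_measurableZ/bb.
pose U x := one_sub_exp v x - \sum_(m < N) f m x.
have bU : bounded_measurable U.
  by apply: bounded_measurableB => //; exact: bounded_measurable_sum.
have Unat (n : nat) : U n%:R = q ^+ minn n N - q ^+ n.
  rewrite /U wv; under eq_bigr do rewrite /f beyondE.
  by rewrite geom; ring.
have Ule K : natural_positive K ->
    (1 - q) * K (@beyond R N) <= K U / q ^+ N <= K (@beyond R N).
  move=> [_ KZ KM]; apply/andP; split.
    rewrite ler_pdivlMr// mulrAC -KZ//; apply: KM => //; first exact: bounded_measurableZ.
    move=> n; rewrite Unat beyondE; have [Nn|nN] := ltnP N n.
      rewrite mulr1 mulrBl mul1r lerB// -exprS.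
      by rewrite ler_wiXn2l// ?ltW.
    by rewrite mulr0 subrr.
  rewrite ler_pdivrMr// mulrC -KZ//; apply: KM => //; first exact: bounded_measurableZ.
  move=> n; rewrite Unat beyondE; have [Nn|nN] := ltnP N n.
    by rewrite mulr1 gerBl exprn_ge0// ltW.
  by rewrite mulr0 subrr.
have KU K : natural_positive K ->
    K U = K (one_sub_exp v) - \sum_(m < N) ((1 - q) * q ^+ m) * K (@beyond R m).
  move=> KP; rewrite /U natural_positiveB//; last exact: bounded_measurable_sum.
  rewrite natural_positive_sum//; congr (_ - _); apply: eq_bigr => m _.
  by have [_ KZ _] := KP; rewrite KZ.
have cU : J h U / q ^+ N @[h --> 0^'+] --> nu U / q ^+ N.
  apply: cvgM; last exact: cvg_cst.
  have : J h (one_sub_exp v) - \sum_(m < N) ((1 - q) * q ^+ m) * J h (@beyond R m)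
      @[h --> 0^'+] --> nu U.
    rewrite KU//; apply: cvgB; first exact: Jlaplace.
    apply: (cvg_big (op := +%R)) => [|m _]; first exact: add_continuous.
    by apply: cvgM; [exact: cvg_cst|exact: IH].
  apply: cvg_trans; apply: near_eq_cvg; near=> h.
  by rewrite KU//; apply: JP; near: h; exact: nbhs_right_gt.
have e20 : 0 < e / 2 by rewrite divr_gt0.
move/cvgrPdist_lt : cU => /(_ _ e20) cU.
near=> h.
have h0 : 0 < h by near: h; exact: nbhs_right_gt.
have /andP[h1 h2] := Ule _ (JP h0).
have /andP[n1 n2] := Ule _ nuP.
have : `|nu U / q ^+ N - J h U / q ^+ N| < e / 2 by near: h.
rewrite -/E in n1 n2; rewrite !ltr_norml => /andP[d1 d2].
have key : (1 - q) * (E + e) = E + e - e / 2 by rewrite mulrBl mul1r qE.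
have qEe : q * E <= e / 2 by rewrite -qE ler_wpM2l ?(ltW q0)// lerDl (ltW e0).
have up : J h (@beyond R N) < E + e.
  by rewrite -(ltr_pM2l (_ : 0 < 1 - q)) ?subr_gt0// key; lra.
by rewrite mulrBl mul1r in n1; apply/andP; split; lra.
Unshelve. all: end_near. Qed.

Hypothesis nu_tail : nu (@beyond R N) @[N --> \oo] --> 0.

(** The mass at m + 1 is the difference of two consecutive tails, hence converges.
    Finitely many masses suffice because the tails of [nu] vanish, which makes the
    tails of [J h] small as well, for small h. *)
Lemma laplace_cvg (g : R -> R) (C : R) :
  measurable_fun setT g -> (forall x, `|g x| <= C) -> g 0 = 0 ->
  J h g @[h --> 0^'+] --> nu g.
Proof.
move=> mg gC g0.
have C0 : 0 <= C by apply: le_trans (gC 0); exact: normr_ge0.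
have bb m := bounded_measurable_beyond R m.
have ba m := bounded_measurable_at_nat R m.
have Kat K m : natural_positive K ->
    K (@at_nat R m.+1) = K (@beyond R m) - K (@beyond R m.+1).
  move=> KP; rewrite -natural_positiveB//; apply: natural_positive_ext => //.
    exact: bounded_measurableB.
  move=> n; rewrite at_natE !beyondE.
  have [nm|mn] := leqP n m.
    by rewrite ltn_eqF// ltnNge (leqW nm) subrr.
  by rewrite [(m.+1 < n)%N]ltn_neqAle mn andbT eq_sym; case: eqP; rewrite ?subrr ?subr0.
have cat m : J h (@at_nat R m.+1) @[h --> 0^'+] --> nu (@at_nat R m.+1).
  have : J h (@beyond R m) - J h (@beyond R m.+1) @[h --> 0^'+] --> nu (@at_nat R m.+1).
    by rewrite Kat//; apply: cvgB; exact: laplace_cvg_beyond.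
  apply: cvg_trans; apply: near_eq_cvg; near=> h.
  by rewrite Kat//; apply: JP; near: h; exact: nbhs_right_gt.
apply/cvgrPdist_lt => e e0.
have e40 : 0 < e / 4 by rewrite divr_gt0.
have [N CN] : exists N, C * nu (@beyond R N) < e / 4.
  have : C * nu (@beyond R N) @[N --> \oo] --> 0.
    by rewrite -[X in _ --> X](mulr0 C); apply: cvgM; [exact: cvg_cst|].
  move=> /cvgrPdist_lt /(_ _ e40) [N _ HN]; exists N.
  by have := HN N (leqnn N); rewrite /= sub0r normrN; apply: le_lt_trans; exact: ler_norm.
pose S (K : (R -> R) -> R) := \sum_(j < N) g j.+1%:R * K (@at_nat R j.+1).
have cS : S (J h) @[h --> 0^'+] --> S nu.
  apply: (cvg_big (op := +%R)) => [|m _]; first exact: add_continuous.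
  by apply: cvgM; [exact: cvg_cst|exact: cat].
have cB : C * J h (@beyond R N) @[h --> 0^'+] --> C * nu (@beyond R N).
  by apply: cvgM; [exact: cvg_cst|exact: laplace_cvg_beyond].
have cB' : \forall h \near 0^'+, C * J h (@beyond R N) < e / 4 by exact: (cvgr_lt _ cB).
move/cvgrPdist_lt : cS => /(_ _ e40) cS.
near=> h.
have h0 : 0 < h by near: h; exact: nbhs_right_gt.
have t1 := natural_positive_trunc (JP h0) N mg gC g0.
have t2 := natural_positive_trunc nuP N mg gC g0.
have t3 : `|S nu - S (J h)| < e / 4 by near: h.
have t4 : C * J h (@beyond R N) < e / 4 by near: h.
rewrite -/(S _) in t1 t2.
have -> : nu g - J h g = (nu g - S nu) + (S nu - S (J h)) + (S (J h) - J h g) by ring.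
rewrite (le_lt_trans (ler_normD _ _))//.
apply: le_lt_trans (lerD (ler_normD _ _) (lexx _)) _.
rewrite (distrC (S (J h))); lra.
Unshelve. all: end_near. Qed.

End laplace_continuity.

(** * Gamma integrals *)

Section gamma_integrals.
Context (R : realType).
Notation mu := (@lebesgue_measure R).

Let mulr_measurable (r : R) : measurable_fun setT (fun x : R => r * x).
Proof. exact: measurable_funM. Qed.

(** Lebesgue measure is r times its own image under x |-> r x, since both measures
    agree on intervals. *)
Lemma ge0_integral_scale (r : R) (f : R -> \bar R) : 0 < r ->
  measurable_fun setT f -> (forall x, 0 <= f x)%E ->
  (\int[mu]_x f x = r%:E * \int[mu]_x f (r * x)%R)%E.
Proof.
move=> r0 mf f0.
pose phi : measurableTypeR R -> measurableTypeR R := fun x => r * x.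
have mphi : measurable_fun [set: measurableTypeR R] phi by exact: mulr_measurable.
pose phi' : {mfun measurableTypeR R >-> measurableTypeR R} := HB.pack phi
  (isMeasurableFun.Build _ _ _ _ phi mphi).
pose nn : {nonneg R} := NngNum (ltW r0).
pose m0 : {measure set (measurableTypeR R) -> \bar R} := mscale nn (@pushforward _ _ _ _ R mu phi').
pose m := m0 mphi.
have mE A : measurable A -> mu A = m A.
  move=> mA; apply: lebesgue_measure_unique => // _ [[x y]] _ <-.
  rewrite -[RHS]/(r%:E * mu (phi @^-1` `]x, y]%classic))%E.
  rewrite (_ : phi @^-1` _ = `](x / r), (y / r)]%classic); last first.
    apply/seteqP; split => z /=; rewrite !in_itv/= /phi;
    by rewrite ltr_pdivrMr// ler_pdivlMr// mulrC.
  rewrite !lebesgue_measure_itv/= !lte_fin ltr_pM2r ?invr_gt0//.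
  case: ifP => _; rewrite ?mule0// -EFinB -EFinM; congr EFin; field.
  by rewrite gt_eqF.
rewrite -[X in (_ * X)%E]/(\int[mu]_x (f \o phi') x)%E.
transitivity (\int[m]_x f x)%E.
  by apply: eq_measure_integral => A mA _; exact: mE.
rewrite ge0_integral_mscale//=; congr *%E.
by rewrite ge0_integral_pushforward.
Qed.

(** The factor (0 < y) extends the integrand y^(a - 1) e^(-r y) by 0, so that all
    integrals range over the whole line. *)
Definition gamma_kernel (a r y : R) : R :=
  (0 < y)%R%:R * (y `^ (a - 1) * expR (- (r * y))).

Lemma gamma_kernel_ge0 a r y : 0 <= gamma_kernel a r y.
Proof. by rewrite /gamma_kernel mulr_ge0// mulr_ge0 ?powR_ge0 ?expR_ge0. Qed.

Lemma measurable_gt0 : measurable_fun setT (fun y : R => (0 < y)%R%:R : R).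
Proof.
rewrite (_ : (fun y => _) = \1_(`]0, +oo[%classic)); first exact: measurable_indic.
apply/funext => y; rewrite indicE; congr (nat_of_bool _)%:R.
by apply/idP/idP => [y0|/set_mem /=]; 
  [apply/mem_set; rewrite /= in_itv/= andbT|rewrite in_itv/= andbT].
Qed.

Lemma measurable_gamma_kernel2 a :
  measurable_fun setT (fun z : R * R => gamma_kernel a z.2 z.1).
Proof.
rewrite /gamma_kernel; apply: measurable_funM.
  exact: (measurableT_comp measurable_gt0 measurable_fst).
apply: measurable_funM.
  exact: (measurableT_comp (measurable_powR (a - 1)) measurable_fst).
apply: (measurableT_comp (@measurable_expR R)).
apply: (measurableT_comp (@oppr_measurable R setT)).
exact: measurable_funM.
Qed.

Lemma measurable_gamma_kernel a r : measurable_fun setT (gamma_kernel a r).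
Proof.
have mp : measurable_fun setT (fun y : R => (y, r)) by apply: measurable_fun_pair.
exact: (measurableT_comp (measurable_gamma_kernel2 a) mp).
Qed.

(** The value Gamma(a) / r^a as an extended real: scaling and summation need no
    integrability, and finiteness is proved only where a real value is wanted. *)
Definition egamma (a r : R) : \bar R := (\int[mu]_y (gamma_kernel a r y)%:E)%E.

Lemma egamma_ge0 a r : (0 <= egamma a r)%E.
Proof. by apply: integral_ge0 => y _; rewrite lee_fin gamma_kernel_ge0. Qed.

Lemma GammaE a : Gamma a = fine (egamma a 1).
Proof.
rewrite /Gamma /Rintegral; congr fine; rewrite integral_mkcond; apply: eq_integral => y _.
rewrite patchE /gamma_kernel mul1r; case: ifPn => [/set_mem|/negP y0] /=.
  by rewrite in_itv/= andbT => ->; rewrite mul1r.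
have -> : (0 < y) = false; last by rewrite mul0r.
by apply/negP => yp; apply: y0; apply/mem_set; rewrite /= in_itv/= andbT.
Qed.

Lemma egamma_scale a r : 0 < r -> egamma a r = ((r `^ (- a))%:E * egamma a 1)%E.
Proof.
move=> r0.
have E : egamma a 1 = ((r `^ a)%:E * egamma a r)%E.
  rewrite /egamma (@ge0_integral_scale r)//; last 2 first.
  - by apply/measurable_EFinP; exact: measurable_gamma_kernel.
  - by move=> x; rewrite lee_fin gamma_kernel_ge0.
  have e y : gamma_kernel a 1 (r * y) = r `^ (a - 1) * gamma_kernel a r y.
    rewrite /gamma_kernel pmulr_rgt0// mul1r.
    have [y0|y0] := ltP 0 y; last by rewrite !mul0r mulr0.
    by rewrite !mul1r powRM ?ltW// mulrA.
  under eq_integral do rewrite e EFinM.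
  rewrite ge0_integralZl//.
  - rewrite muleA -EFinM -{1}(powRr1 (ltW r0)) -powRD ?(gt_eqF r0) ?implybT//.
    by rewrite addrC subrK.
  - by apply/measurable_EFinP; exact: measurable_gamma_kernel.
  - by move=> x _; rewrite lee_fin gamma_kernel_ge0.
  - by rewrite lee_fin powR_ge0.
by rewrite E muleA -EFinM powRN mulVf ?mul1e// gt_eqF// powR_gt0.
Qed.

Lemma integral_powR (c b a : R) : 0 < c -> 0 < b -> b < a ->
  (\int[mu]_(x in `[b, a]) (x `^ (c - 1))%:E = ((a `^ c - b `^ c) / c)%:E)%E.
Proof.
move=> c0 b0 ba.
have cp z : 0 < z -> {for z, continuous (fun x : R => x `^ c)}.
  move=> z0; apply/differentiable_continuous/derivable1_diffP.
  by apply: derivable_powR; rewrite in_itv/= z0.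
have cp1 z : 0 < z -> {for z, continuous (fun x : R => x `^ (c - 1))}.
  move=> z0; apply/differentiable_continuous/derivable1_diffP.
  by apply: derivable_powR; rewrite in_itv/= z0.
rewrite (@continuous_FTC2 _ _ (fun x => x `^ c / c))//.
- by rewrite -EFinB mulrBl.
- apply: continuous_in_subspaceT => x; rewrite inE/= in_itv/= => /andP[bx _].
  by apply: cp1; exact: lt_le_trans bx.
- split.
  + move=> x; rewrite in_itv/= => /andP[bx _]; apply: derivableM => //.
    by apply: derivable_powR; rewrite in_itv/= (lt_trans b0).
  + by apply: cvgM; [apply: cvg_at_right_filter; exact: cp|exact: cvg_cst].
  + apply: cvgM; [apply: cvg_at_left_filter; apply: cp; exact: lt_trans ba|exact: cvg_cst].
- move=> x; rewrite in_itv/= => /andP[bx _]; have x0 := lt_trans b0 bx.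
  have I := is_derive1_powR c x0.
  have D : is_derive x 1 (fun x => x `^ c / c) (x `^ (c - 1)).
    apply: is_derive_eq; rewrite /GRing.scale/=; field.
    by rewrite gt_eqF.
  by rewrite derive1E; exact: derive_val.
Qed.

(** The interval ]0, 1] is exhausted by the intervals [1/(n+2), 1], on which the
    integral is at most 1/c by the fundamental theorem of calculus. *)
Lemma integral_powR01_lty (c : R) : 0 < c ->
  (\int[mu]_(x in `]0%R, 1%R]) (x `^ (c - 1))%:E < +oo)%E.
Proof.
move=> c0.
pose F (n : nat) : set R := `[n.+2%:R^-1, 1]%classic.
have -> : `]0%R, 1%R]%classic = \bigcup_n F n.
  apply/seteqP; split => x /=; rewrite ?in_itv/=.
    move=> /andP[x0 x1].
    exists (Num.truncn x^-1) => //; rewrite /F /= in_itv/= x1 andbT.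
    rewrite -[leRHS]invrK lef_pV2 ?posrE ?invr_gt0// (le_trans (ltW (truncnS_gt _)))//.
    by rewrite ler_nat.
  move=> [n _]; rewrite /F /= !in_itv/= => /andP[nx ->]; rewrite andbT.
  by apply: lt_le_trans nx; rewrite invr_gt0.
have mF i : measurable (F i) by exact: measurable_itv.
have ndF : nondecreasing_seq F.
  move=> m n mn; rewrite subsetEset => x; rewrite /F /= !in_itv/= => /andP[mx ->].
  by rewrite andbT (le_trans _ mx)// lef_pV2 ?posrE// ler_nat !ltnS.
have cv := @ge0_nondecreasing_set_cvg_integral _ (measurableTypeR R) R F
  (fun x => (x `^ (c - 1))%:E) mu ndF mF.
apply: (@le_lt_trans _ _ (1 / c)%:E); last exact: ltry.
apply: (cvge_to_le (cv _ _)).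
- move=> i; apply/measurable_EFinP; apply: measurable_funTS; exact: measurable_powR.
- by move=> i x _; rewrite lee_fin powR_ge0.
apply: nearW => n; rewrite /F integral_powR// ?invr_gt0//; last first.
  by rewrite invf_lt1// ltr1n.
by rewrite lee_fin ler_pM2r ?invr_gt0// powR1 gerBl powR_ge0.
Qed.

(** The integrand is at most y^(c - 1) on ]0, 1] and at most e^(-y) beyond 1. *)
Lemma egamma_lty (c : R) : 0 < c -> c <= 1 -> (egamma c 1 < +oo)%E.
Proof.
move=> c0 c1.
pose f (y : R) : \bar R := ((fun y => (y `^ (c - 1))%:E) \_ `]0%R, 1%R]) y.
have f0 y : (0 <= f y)%E.
  by rewrite /f patchE; case: ifP => // _; rewrite lee_fin powR_ge0.
have mf : measurable_fun setT f.
  apply/(measurable_restrictT (fun y => (y `^ (c - 1))%:E)); first exact: measurable_itv.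
  by apply: measurable_funTS; apply/measurable_EFinP; exact: measurable_powR.
have me : measurable_fun setT (fun y : R => (exponential_pdf 1 y)%:E).
  by apply/measurable_EFinP; exact: measurable_exponential_pdf.
have e0 y : (0 <= (exponential_pdf (1 : R) y)%:E)%E.
  by rewrite lee_fin exponential_pdf_ge0.
apply: (@le_lt_trans _ _ (\int[mu]_y (f y + (exponential_pdf 1 y)%:E))%E).
  apply: ge0_le_integral => //.
  - by move=> y _; rewrite lee_fin gamma_kernel_ge0.
  - by apply/measurable_EFinP; exact: measurable_gamma_kernel.
  - exact: emeasurable_funD.
  - move=> y _; rewrite /gamma_kernel; have [y0|y0] := ltP 0 y; last first.
      by rewrite mul0r adde_ge0.
    rewrite !mul1r; have [y1|y1] := leP y 1.
      rewrite /f patchE mem_set/= ?in_itv/= ?y0//.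
      rewrite (@le_trans _ _ ((y `^ (c - 1))%:E))// ?leeDl//.
      by rewrite lee_fin ler_piMr ?powR_ge0// -[leRHS]expR0 ler_expR oppr_le0 ltW.
    apply: (@le_trans _ _ (exponential_pdf 1 y)%:E); last by rewrite leeDr.
    rewrite (exponential_pdfE _ (ltW y0)) mul1r mulN1r lee_fin.
    rewrite ler_piMl ?expR_ge0//; apply: le_trans (ler_powR (ltW y1) (_ : c - 1 <= 0)) _.
      by rewrite subr_le0.
    by rewrite powRr0.
rewrite ge0_integralD// integral_exponential_pdf// lte_add_pinfty ?ltry//.
by rewrite /f -integral_mkcond integral_powR01_lty.
Qed.

(** The integrand is bounded below on [1, 2]. *)
Lemma egamma1_gt0 (c : R) : c <= 1 -> (0 < egamma c 1)%E.
Proof.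
move=> c1.
pose dl : R := 2 `^ (c - 1) * expR (- 2).
have d0 : 0 < dl by rewrite mulr_gt0 ?powR_gt0 ?expR_gt0.
have mi : measurable (`[1%R, 2%R]%classic : set R) by exact: measurable_itv.
apply: (@lt_le_trans _ _ (\int[mu]_(y in `[1%R, 2%R]) dl%:E)%E).
  rewrite integral_cst//= lebesgue_measure_itv/= lte_fin ltr1n -EFinB -EFinM lte_fin.
  by rewrite mulr_gt0// subr_gt0 ltr1n.
apply: (@le_trans _ _ (\int[mu]_(y in `[1%R, 2%R]) (gamma_kernel c 1 y)%:E)%E).
  apply: ge0_le_integral => //.
  - by move=> y _; rewrite lee_fin ltW.
  - by apply: measurable_funTS; apply/measurable_EFinP; exact: measurable_gamma_kernel.
  - move=> y /=; rewrite in_itv/= => /andP[y1 y2]; rewrite lee_fin /gamma_kernel.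
    have y0 : 0 < y by exact: lt_le_trans y1.
    rewrite y0 mul1r mul1r ler_pM ?powR_ge0 ?expR_ge0//; last by rewrite ler_expR lerN2.
    rewrite -(opprB 1 c) !powRN lef_pV2 ?posrE ?powR_gt0//.
    by apply: ge0_ler_powR; rewrite ?nnegrE ?subr_ge0 ?(ltW y0).
apply: ge0_subset_integral => //.
- by apply/measurable_EFinP; exact: measurable_gamma_kernel.
- by move=> y _; rewrite lee_fin gamma_kernel_ge0.
Qed.

(** This is z <= e^z at z = y / (2 (n + 1)), raised to the power n. *)
Lemma pow_le_exp (n : nat) (y : R) : 0 <= y ->
  y ^+ n <= (2 * n.+1%:R) ^+ n * expR (2^-1 * y).
Proof.
move=> y0; set N := 2 * n.+1%:R; have N0 : 0 < N by rewrite mulr_gt0.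
have h : y / N <= expR (y / N).
  by apply: le_trans (expR_ge1Dx _); rewrite lerDr.
have -> : y ^+ n = N ^+ n * (y / N) ^+ n by rewrite -exprMn mulrC divfK// gt_eqF.
rewrite ler_wpM2l ?exprn_ge0 ?(ltW N0)//.
apply: (@le_trans _ _ (expR (y / N) ^+ n)).
  by rewrite lerXn2r ?nnegrE ?divr_ge0 ?expR_ge0 ?(ltW N0).
rewrite -expRM_natl ler_expR /N.
rewrite (_ : n%:R * _ = (2^-1 * y) * (n%:R / n.+1%:R)); last first.
  by field; rewrite ?natr1 ?nat1r ?pnatr_eq0.
by rewrite ler_piMr ?mulr_ge0// ler_pdivrMr// mul1r ler_nat.
Qed.

(** The factor y^n is absorbed by half of the exponential, which leaves the
    exponent 1 - theta at rate 1/2. *)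
Lemma egamma_nat_lty (theta : R) (n : nat) : 0 < theta -> theta < 1 ->
  (egamma (n.+1%:R - theta) 1 < +oo)%E.
Proof.
move=> t0 t1.
pose C : R := (2 * n.+1%:R) ^+ n.
have C0 : 0 <= C by rewrite exprn_ge0// mulr_ge0.
apply: (@le_lt_trans _ _ (C%:E * egamma (1 - theta) 2^-1)%E).
  rewrite /egamma -ge0_integralZl//; last 2 first.
  - by apply/measurable_EFinP; exact: measurable_gamma_kernel.
  - by move=> y _; rewrite lee_fin gamma_kernel_ge0.
  apply: ge0_le_integral => //.
  - by move=> y _; rewrite lee_fin gamma_kernel_ge0.
  - by apply/measurable_EFinP; exact: measurable_gamma_kernel.
  - by apply: measurable_funeM; apply/measurable_EFinP; exact: measurable_gamma_kernel.
  - move=> y _; rewrite -EFinM lee_fin /gamma_kernel; have [y0|y0] := ltP 0 y; last first.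
      by rewrite !mul0r mulr0.
    rewrite !mul1r.
    have -> : n.+1%:R - theta - 1 = n%:R + (1 - theta - 1) by rewrite -natr1; ring.
    rewrite (@powRD _ y n%:R); last by rewrite (gt_eqF y0) implybT.
    rewrite powR_mulrn ?(ltW y0)// -mulrA.
    have -> : expR (- y) = expR (- (2^-1 * y)) * expR (- (2^-1 * y)).
      by rewrite -expRD; congr expR; lra.
    rewrite (_ : C * _ = (C * expR (2^-1 * y)) * (y `^ (1 - theta - 1) *
       (expR (- (2^-1 * y)) * expR (- (2^-1 * y))))); last first.
      rewrite (expRN (2^-1 * y)); field; exact: lt0r_neq0 (expR_gt0 _).
    apply: ler_wpM2r; last exact: pow_le_exp (ltW y0).
    by rewrite !mulr_ge0 ?powR_ge0 ?expR_ge0.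
rewrite egamma_scale// muleA -EFinM lte_mul_pinfty ?lee_fin//.
  by rewrite mulr_ge0// powR_ge0.
by apply: egamma_lty; rewrite ?subr_gt0// gerBl ltW.
Qed.

Lemma integral_expR_itv (y b a : R) : 0 < y -> b <= a ->
  (\int[mu]_(r in `[b, a]) (expR (- (r * y)))%:E =
   ((expR (- (b * y)) - expR (- (a * y))) / y)%:E)%E.
Proof.
move=> y0; rewrite le_eqVlt => /predU1P[->|ba].
  by rewrite set_itv1 integral_set1 subrr mul0r.
have D (r : R) : is_derive r 1 (fun r : R => - (expR (- (r * y)) / y)) (expR (- (r * y))).
  apply: is_derive_eq; rewrite /GRing.scale/=; field.
  by rewrite gt_eqF.
have cf : continuous (fun r : R => expR (- (r * y))).
  move=> r; apply: continuous_comp; last exact: continuous_expR.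
  by apply: continuousN; apply: continuousM; [exact: cvg_id|exact: cst_continuous].
have cF (r : R) : {for r, continuous (fun r : R => - (expR (- (r * y)) / y))}.
  by apply/differentiable_continuous/derivable1_diffP; have [] := D r.
rewrite (@continuous_FTC2 _ _ (fun r : R => - (expR (- (r * y)) / y)))//.
- by rewrite -EFinB; congr EFin; ring.
- exact: continuous_subspaceT.
- split.
  + by move=> r _; have [] := D r.
  + by apply: cvg_at_right_filter; exact: cF.
  + by apply: cvg_at_left_filter; exact: cF.
- by move=> r _; rewrite derive1E; exact: derive_val.
Qed.

Let GammaEfin (theta : R) : 0 < theta -> theta < 1 ->
  egamma (1 - theta) 1 = (Gamma (1 - theta))%:E.
Proof.
move=> t0 t1; rewrite GammaE fineK// ge0_fin_numE ?egamma_ge0//.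
by apply: egamma_lty; rewrite ?subr_gt0// gerBl ltW.
Qed.

(** Integrating this kernel in r and then in y, or in the opposite order, gives
    the two sides of [integral_exp_diff]. *)
Let kernel_itv (theta a b : R) (z : R * R) : \bar R :=
  (gamma_kernel (1 - theta) z.2 z.1 * \1_(`[b, a]%classic : set R) z.2)%:E.

Let integral_kernel_itv_rate (theta a b y : R) : b <= a ->
  (\int[mu]_r kernel_itv theta a b (y, r) =
   ((0 < y)%R%:R * (y `^ (- theta - 1) *
      (expR (- (b * y)) - expR (- (a * y)))))%:E)%E.
Proof.
move=> ba; rewrite /kernel_itv /=; have [y0|y0] := ltP 0 y; last first.
  rewrite mul0r integral0_eq// => r _; rewrite /gamma_kernel ltNge y0 /=.
  by rewrite !mul0r.
rewrite mul1r.
have yth : y `^ (- theta) = y * y `^ (- theta - 1).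
  rewrite -[in X in X * _](powRr1 (ltW y0)) -(@powRD _ y 1).
    by congr (_ `^ _); ring.
  by rewrite (gt_eqF y0) implybT.
transitivity (\int[mu]_(r in `[b, a]) ((y `^ (- theta))%:E * (expR (- (r * y)))%:E))%E.
  rewrite [RHS]integral_mkcond; apply: eq_integral => r _.
  rewrite patchE /gamma_kernel y0 mul1r indicE.
  have -> : 1 - theta - 1 = - theta by ring.
  by case: ifP => _; rewrite ?mulr1 ?mulr0// -EFinM.
rewrite ge0_integralZl//.
- rewrite integral_expR_itv// -EFinM yth; congr EFin; field.
  by rewrite gt_eqF.
- apply/measurable_EFinP; apply: measurable_funTS.
  apply: (measurableT_comp (@measurable_expR R)).
  apply: (measurableT_comp (@oppr_measurable R setT)).
  exact: measurable_funM.
- by rewrite lee_fin powR_ge0.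
Qed.

Let integral_kernel_itv_size (theta a b r : R) :
  0 < theta -> theta < 1 -> 0 < b ->
  (\int[mu]_y kernel_itv theta a b (y, r) =
   ((fun r => (Gamma (1 - theta))%:E * (r `^ (theta - 1))%:E) \_ `[b, a]) r)%E.
Proof.
move=> t0 t1 b0; rewrite patchE /kernel_itv /= indicE.
have [/set_mem /= rin|rin] := boolP (r \in `[b, a]%classic); last first.
  by rewrite integral0_eq// => y _; rewrite mulr0.
move: rin; rewrite in_itv/= => /andP[br ra]; have r0 : 0 < r by exact: lt_le_trans br.
under eq_integral do rewrite mulr1.
rewrite -/(egamma (1 - theta) r) egamma_scale// GammaEfin// muleC.
by congr (_ * (_ `^ _)%:E)%E; ring.
Qed.

(** Since (e^(-b y) - e^(-a y)) / y is the integral of e^(-r y) over r in [b, a],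
    Tonelli's theorem reduces the left-hand side to the integral of
    Gamma(1 - theta) r^(theta - 1) over [b, a]. *)
Lemma integral_exp_diff (theta a b : R) : 0 < theta -> theta < 1 -> 0 < b -> b <= a ->
  (\int[mu]_y ((0 < y)%R%:R * (y `^ (- theta - 1) *
      (expR (- (b * y)) - expR (- (a * y)))))%:E =
   (Gamma (1 - theta) / theta * (a `^ theta - b `^ theta))%:E)%E.
Proof.
move=> t0 t1 b0 ba.
transitivity (\int[mu]_y \int[mu]_r kernel_itv theta a b (y, r))%E.
  by apply: eq_integral => y _; rewrite integral_kernel_itv_rate.
transitivity (\int[mu]_r \int[mu]_y kernel_itv theta a b (y, r))%E.
  apply: fubini_tonelli.
    apply/measurable_EFinP; apply: measurable_funM.
      exact: measurable_gamma_kernel2.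
    have m1 : measurable_fun setT (\1_(`[b, a]%classic) : R -> R).
      by apply: measurable_indic; exact: measurable_itv.
    exact: (measurableT_comp m1 measurable_snd).
  by move=> z; rewrite lee_fin mulr_ge0// gamma_kernel_ge0.
under eq_integral do rewrite integral_kernel_itv_size//.
rewrite -integral_mkcond ge0_integralZl//.
- move: ba; rewrite le_eqVlt => /predU1P[->|ba].
    by rewrite set_itv1 integral_set1 mule0 subrr mulr0.
  by rewrite integral_powR// -EFinM; congr EFin; rewrite mulrCA mulrC.
- by apply/measurable_EFinP; apply: measurable_funTS; exact: measurable_powR.
- by move=> r _; rewrite lee_fin powR_ge0.
- by rewrite -(GammaEfin t0 t1) egamma_ge0.
Qed.

End gamma_integrals.

(** * The exponential series over compositions *)

Section compositions.
Context (k : nat).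

Definition weight (x : {ffun 'I_k -> nat}) : nat := (\sum_(j < k) j.+1 * x j)%N.

(** Functions with values below m form a finite type, over which a product of
    partial sums distributes; every element of Omega(k, n) is of this form once
    m > n. *)
Definition of_box (m : nat) (y : {ffun 'I_k -> 'I_m}) : {ffun 'I_k -> nat} :=
  [ffun j => nat_of_ord (y j)].

Lemma of_box_inj m : injective (@of_box m).
Proof.
move=> y y' /ffunP e; apply/ffunP => j; apply: val_inj.
by have := e j; rewrite !ffunE.
Qed.

Lemma le_weight (x : {ffun 'I_k -> nat}) j : (x j <= weight x)%N.
Proof.
by rewrite /weight (bigD1 j)//= (leq_trans _ (leq_addr _ _))// leq_pmull.
Qed.

Lemma Omega_sub_box n m : (n < m)%N -> Omega k n `<=` range (@of_box m).
Proof.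
move=> nm x xn.
have xm j : (x j < m)%N by apply: leq_ltn_trans (le_weight x j) _; rewrite /weight xn.
exists [ffun j => Ordinal (xm j)] => //.
by apply/ffunP => j; rewrite !ffunE.
Qed.

Lemma finite_Omega n : finite_set (Omega k n).
Proof.
apply: sub_finite_set (Omega_sub_box (ltnSn n)) _.
exact/finite_image/finite_finset.
Qed.

Lemma weight_of_box m (y : {ffun 'I_k -> 'I_m}) : (weight (of_box y) <= m * (k * k))%N.
Proof.
rewrite /weight; apply: (@leq_trans (\sum_(j < k) m * k)%N).
  apply: leq_sum => j _; rewrite ffunE mulnC leq_mul//.
  exact: ltnW.
by rewrite sum_nat_const card_ord mulnCA.
Qed.

Variable (R : realType).

Lemma sum_Omega_box (G : {ffun 'I_k -> nat} -> R) n m :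
  \sum_(x \in Omega k n `&` range (@of_box m)) G x =
  \sum_(y : {ffun 'I_k -> 'I_m} | weight (of_box y) == n) G (of_box y).
Proof.
rewrite (fsbigE [seq of_box y | y <- enum [pred y : {ffun 'I_k -> 'I_m} | weight (of_box y) == n]]).
- rewrite big_map big_enum_cond/=; apply: eq_bigl => y; rewrite inE/=.
  by apply: andb_idr => /eqP yn; apply/mem_set; split => //; exists y.
- by rewrite map_inj_uniq ?enum_uniq//; exact: of_box_inj.
- move=> x /= /mapP[y]; rewrite mem_enum inE => /eqP yn ->.
  by split => //; exists y.
- move=> x [xn [y _ yx]] /negP[]; apply/mapP; exists y => //.
  by rewrite mem_enum inE yx; exact/eqP.
Qed.

Lemma sum_OmegaE (G : {ffun 'I_k -> nat} -> R) n m : (n < m)%N ->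
  \sum_(x \in Omega k n) G x =
  \sum_(y : {ffun 'I_k -> 'I_m} | weight (of_box y) == n) G (of_box y).
Proof. by move=> nm; rewrite -sum_Omega_box setIidl//; exact: Omega_sub_box. Qed.

Lemma sum_Omega_ge (G : {ffun 'I_k -> nat} -> R) n m : (forall x, 0 <= G x) ->
  \sum_(y : {ffun 'I_k -> 'I_m} | weight (of_box y) == n) G (of_box y) <=
  \sum_(x \in Omega k n) G x.
Proof.
move=> G0; rewrite -sum_Omega_box.
rewrite [leRHS](fsbigID (range (@of_box m)))/=; last exact: finite_Omega.
by rewrite lerDl fsumr_ge0.
Qed.

Variable a : 'I_k -> R.
Hypothesis a0 : forall j, 0 <= a j.

Let F (x : {ffun 'I_k -> nat}) : R := \prod_(j < k) (a j ^+ x j / (x j)`!%:R).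

Let F0 x : 0 <= F x.
Proof. by apply: prodr_ge0 => j _; rewrite divr_ge0// exprn_ge0. Qed.

Let box m : \sum_(y : {ffun 'I_k -> 'I_m}) F (of_box y) =
  \prod_(j < k) series (exp_coeff (a j)) m.
Proof.
under [RHS]eq_bigr do rewrite /series/= big_mkord.
rewrite bigA_distr_bigA; apply: eq_bigr => y _.
by apply: eq_bigr => j _; rewrite /exp_coeff/= ffunE.
Qed.

(** The product over j of the partial exponential series of order m is the sum
    over the box of side m.  The elements of weight below N lie in the box of side
    N, and the box of side m contains only weights up to m k^2, so the partial sums
    of the series are squeezed between these products. *)
Lemma sum_Omega_exp :
  (\sum_(n <oo) (\sum_(x \in Omega k n) F x)%:E = (expR (\sum_(j < k) a j))%:E)%E.
Proof.
have w0 n : (0 <= (\sum_(x \in Omega k n) F x)%:E)%E by rewrite lee_fin fsumr_ge0.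
have cvE j : series (exp_coeff (a j)) @ \oo --> expR (a j) by exact: is_cvg_series_exp_coeff.
rewrite expR_sum; apply/eqP; rewrite eq_le; apply/andP; split.
  apply: lime_le; first by apply: is_cvg_nneseries.
  apply: nearW => N; rewrite sumEFin lee_fin.
  apply: (@le_trans _ _ (\sum_(y : {ffun 'I_k -> 'I_N}) F (of_box y))).
    rewrite big_mkord.
    rewrite (eq_bigr (fun n : 'I_N => \sum_(y : {ffun 'I_k -> 'I_N})
       if weight (of_box y) == n then F (of_box y) else 0)); last first.
      by move=> n _; rewrite (@sum_OmegaE _ n N)// big_mkcond.
    rewrite exchange_big/=; apply: ler_sum => y _.
    rewrite -big_mkcond/=; have [wN|Nw] := ltnP (weight (of_box y)) N.
      by rewrite (big_pred1 (Ordinal wN))// => n /=; rewrite -val_eqE eq_sym.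
    rewrite big_pred0// => n; apply/eqP => e.
    by have := ltn_ord n; rewrite -e ltnNge Nw.
  rewrite box; apply: ler_prod => j _; apply/andP; split.
    by apply: sumr_ge0 => i _; exact: exp_coeff_ge0.
  have nd : nondecreasing_seq (series (exp_coeff (a j))).
    by apply: nondecreasing_series => i _ _; exact: exp_coeff_ge0.
  rewrite -(cvg_lim _ (cvE j))//; apply: nondecreasing_cvgn_le => //.
have cvP : \prod_(j < k) series (exp_coeff (a j)) m @[m --> \oo] --> \prod_(j < k) expR (a j).
  apply: (@cvg_big R _ ( *%R : R -> R -> R) 1 xpredT _ _ _ _
    (fun j m => series (exp_coeff (a j)) m)) => [|j _]; last exact: cvE.
  exact: mul_continuous.
have cvPE : (\prod_(j < k) series (exp_coeff (a j)) m)%:E @[m --> \oo] -->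
    (\prod_(j < k) expR (a j))%:E.
  by apply: cvg_EFin => //; apply: nearW.
apply: (cvge_to_le cvPE); apply: nearW => m.
apply: le_trans (nneseries_lim_ge (m * (k * k)).+1 _) => //.
rewrite sumEFin lee_fin -box big_mkord.
apply: (@le_trans _ _ (\sum_(n < (m * (k * k)).+1) \sum_(y : {ffun 'I_k -> 'I_m})
       if weight (of_box y) == n then F (of_box y) else 0)); last first.
  by apply: ler_sum => n _; rewrite -big_mkcond; exact: sum_Omega_ge.
rewrite exchange_big/=; apply: ler_sum => y _.
rewrite -big_mkcond/= (big_pred1 (Ordinal (weight_of_box y : (_ < _.+1)%N)))//.
Qed.

End compositions.

(** * The Laplace transform of the weights *)

Section levy_weights.
Context (R : realType) (k : nat) (lambda : 'I_k -> R) (theta eta : R).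
Hypothesis lambda0 : forall j, 0 < lambda j.
Hypothesis theta_gt0 : 0 < theta.
Hypothesis theta_lt1 : theta < 1.
Hypothesis eta_gt0 : 0 < eta.
Notation mu := (@lebesgue_measure R).

Let Lambda := \sum_(j < k) lambda j.
Let a := Lambda + eta.

Let Lambda0 : 0 <= Lambda. Proof. by apply: sumr_ge0 => j _; exact: ltW. Qed.
Let agt0 : 0 < a. Proof. by rewrite ltr_wpDl. Qed.

Definition levy_weight (n : nat) : R :=
  \sum_(x \in Omega k n)
    let s := (\sum_(j < k) x j)%N%:R in
    (\prod_(j < k) (lambda j ^+ x j / (x j)`!%:R)) *
    (Gamma (s - theta) / (\sum_(j < k) lambda j + eta) `^ (s - theta)).

Let c (x : {ffun 'I_k -> nat}) : R := \prod_(j < k) (lambda j ^+ x j / (x j)`!%:R).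

Let c0 x : 0 <= c x.
Proof. by apply: prodr_ge0 => j _; rewrite divr_ge0// exprn_ge0// ltW. Qed.

Lemma Gamma_ge0 (z : R) : 0 <= Gamma z.
Proof. by rewrite GammaE fine_ge0// egamma_ge0. Qed.

Lemma levy_weight_ge0 n : 0 <= levy_weight n.
Proof.
by apply: fsumr_ge0 => x _; rewrite mulr_ge0 ?c0// divr_ge0 ?Gamma_ge0 ?powR_ge0.
Qed.

Lemma egamma_natE (s : nat) : (0 < s)%N ->
  egamma (s%:R - theta) a = (Gamma (s%:R - theta) / a `^ (s%:R - theta))%:E.
Proof.
case: s => // s _; rewrite egamma_scale// GammaE powRN EFinM muleC; congr *%E.
by rewrite fineK// ge0_fin_numE ?egamma_ge0// egamma_nat_lty.
Qed.

Lemma Omega_sum_gt0 n x : (0 < n)%N -> Omega k n x -> (0 < \sum_(j < k) x j)%N.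
Proof.
move=> n0 xn; rewrite lt0n; apply/eqP => /eqP; rewrite sum_nat_eq0 => /forallP x0.
move: n0; rewrite -xn big1// => j _; have := x0 j; rewrite implyTb => /eqP ->.
by rewrite muln0.
Qed.

Let E (v : R) (j : 'I_k) : R := expR (- (v * j.+1%:R)).

Let prodE v y n x : Omega k n x ->
  \prod_(j < k) ((lambda j * y * E v j) ^+ x j / (x j)`!%:R) =
  expR (- (v * n%:R)) * (y ^+ (\sum_(j < k) x j) * c x).
Proof.
move=> xn.
have -> : expR (- (v * n%:R)) = \prod_(j < k) E v j ^+ x j.
  rewrite -xn natr_sum mulr_sumr -sumrN expR_sum; apply: eq_bigr => j _.
  by rewrite /E -expRM_natl natrM; congr expR; ring.
rewrite -prodrXr -!big_split/=; apply: eq_bigr => j _.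
by rewrite !exprMn; ring.
Qed.

Let base y : R := (0 < y)%R%:R * (y `^ (- theta - 1) * expR (- (a * y))).

(** Summed over n this is an exponential series in y, integrated over y it is a
    Laplace-weighted [levy_weight]: the interchange of the two operations is
    [levy_weight_series]. *)
Let f v n (y : R) : R :=
  base y * \sum_(x \in Omega k n) \prod_(j < k) ((lambda j * y * E v j) ^+ x j / (x j)`!%:R).

Let f_sum v n y : f v n y =
  \sum_(x \in Omega k n) (expR (- (v * n%:R)) * c x) *
    gamma_kernel ((\sum_(j < k) x j)%N%:R - theta) a y.
Proof.
rewrite /f mulr_fsumr; apply: eq_fsbigr => x /set_mem xn.
rewrite (prodE _ _ xn) /base /gamma_kernel; have [y0|y0] := ltP 0 y; last by rewrite !mul0r mulr0.
rewrite !mul1r -addrA (@powRD _ y _ (- theta - 1)); last by rewrite (gt_eqF y0) implybT.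
by rewrite powR_mulrn ?(ltW y0)//; ring.
Qed.

Let integral_f v n : (0 < n)%N ->
  (\int[mu]_y (f v n y)%:E = (expR (- (v * n%:R)) * levy_weight n)%:E)%E.
Proof.
move=> n0.
have fin : finite_set (Omega k n) by exact: finite_Omega.
under eq_integral do rewrite f_sum -(fsumEFin _ fin).
rewrite ge0_integral_fsum//; last 2 first.
- move=> x; apply/measurable_EFinP; apply: measurable_funM => //.
  exact: measurable_gamma_kernel.
- move=> x y _; rewrite lee_fin; apply: mulr_ge0; last exact: gamma_kernel_ge0.
  by apply: mulr_ge0; [exact: expR_ge0|exact: c0].
rewrite /levy_weight mulr_fsumr -fsumEFin; last exact: finite_Omega.
apply: eq_fsbigr => x /set_mem xn.
under eq_integral do rewrite EFinM.
rewrite ge0_integralZl//; last 3 first.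
- by apply/measurable_EFinP; exact: measurable_gamma_kernel.
- by move=> y _; rewrite lee_fin gamma_kernel_ge0.
- by rewrite lee_fin mulr_ge0 ?expR_ge0 ?c0.
rewrite -/(egamma _ _) egamma_natE; last exact: Omega_sum_gt0 xn.
by rewrite -EFinM -mulrA.
Qed.

(** The term n = 0 missing from the sum is the constant term 1 of the exponential
    series. *)
Let sum_f v y : 0 <= v ->
  (\sum_(1 <= n <oo) (f v n y)%:E =
   (base y * (expR (y * \sum_(j < k) lambda j * E v j) - 1))%:E)%E.
Proof.
move=> v0; have [y0|y0] := ltP 0 y; last first.
  have b0 : base y = 0 by rewrite /base ltNge y0 mul0r.
  rewrite b0 mul0r; apply: eseries0 => n _ _; by rewrite /f b0 mul0r.
pose H n := \sum_(x \in Omega k n) \prod_(j < k) ((lambda j * y * E v j) ^+ x j / (x j)`!%:R).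
have a0 j : 0 <= lambda j * y * E v j.
  by rewrite !mulr_ge0 ?expR_ge0 ?(ltW y0)// ltW.
have H0 n : (0 <= (H n)%:E)%E.
  rewrite lee_fin; apply: fsumr_ge0 => x _; apply: prodr_ge0 => j _.
  by rewrite divr_ge0// exprn_ge0.
have Hz : H 0%N = 1.
  rewrite /H (_ : Omega k 0 = [set [ffun=> 0%N]]).
    by rewrite fsbig_set1 big1// => j _; rewrite ffunE expr0 fact0 divr1.
  apply/seteqP; split => x /=.
    move=> x0; apply/ffunP => j; rewrite ffunE; apply/eqP; rewrite -leqn0.
    by rewrite -x0; exact: le_weight.
  by move=> ->; rewrite /Omega /= big1// => j _; rewrite ffunE muln0.
have := sum_Omega_exp a0; rewrite -/(H _).
rewrite (@nneseries_recl _ xpredT (fun n => (H n)%:E))// Hz => HE.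
have S : (\sum_(1 <= n <oo) (H n)%:E = (expR (y * \sum_(j < k) lambda j * E v j) - 1)%:E)%E.
  move: HE; have -> : \sum_(j < k) lambda j * y * E v j = y * \sum_(j < k) lambda j * E v j.
    by rewrite mulr_sumr; apply: eq_bigr => j _; rewrite mulrA (mulrC y).
  set s1 := (\sum_(1 <= n <oo) _)%E; case: s1 => [r||] //= [<-].
  by congr EFin; ring.
by rewrite EFinM -S -nneseriesZl// => n _; rewrite H0.
Qed.

(** Given that D jumps by y, the process Z jumps by M_y, so up to a constant the
    weights are the probabilities of M_y mixed by the Levy density
    y^(-theta - 1) e^(-eta y) of D.
    All terms being nonnegative, the sum over n may be taken under the integral,
    where [integral_exp_diff] evaluates it. *)
Lemma levy_weight_series v : 0 <= v ->
  (\sum_(1 <= n <oo) (expR (- (v * n%:R)) * levy_weight n)%:E =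
   (Gamma (1 - theta) / theta *
     ((\sum_(j < k) lambda j + eta) `^ theta -
      (eta + laplace_exponent lambda v) `^ theta))%:E)%E.
Proof.
move=> v0.
pose S := \sum_(j < k) lambda j * E v j.
have bE : eta + laplace_exponent lambda v = a - S.
  rewrite /laplace_exponent /a /S /Lambda.
  under eq_bigr do rewrite mulrBr mulr1.
  by rewrite sumrB; ring.
have S0 : 0 <= S by apply: sumr_ge0 => j _; rewrite mulr_ge0 ?expR_ge0 ?ltW.
have SL : S <= Lambda.
  apply: ler_sum => j _; rewrite ler_piMr ?(ltW (lambda0 j))//.
  by rewrite -[leRHS]expR0 ler_expR oppr_le0 mulr_ge0.
have b0 : 0 < a - S by rewrite subr_gt0 (le_lt_trans SL)// ltrDl.
have ba : a - S <= a by rewrite gerBl.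
rewrite bE -/Lambda -/a -integral_exp_diff//.
transitivity (\int[mu]_y \sum_(1 <= n <oo) (f v n y)%:E)%E.
  have f0 n y : (0 <= (f v n y)%:E)%E.
    rewrite lee_fin f_sum; apply: fsumr_ge0 => x _; apply: mulr_ge0; last exact: gamma_kernel_ge0.
    by apply: mulr_ge0; [exact: expR_ge0|exact: c0].
  have mf n : measurable_fun setT (fun y => (f v n y)%:E).
    under eq_fun do rewrite f_sum -(fsumEFin _ (@finite_Omega k n)).
    apply: emeasurable_fsum; first exact: finite_Omega.
    move=> x; apply/measurable_EFinP; apply: measurable_funM => //.
    exact: measurable_gamma_kernel.
  under [RHS]eq_integral do rewrite -(nneseries_addn 1)//.
  rewrite integral_nneseries//; last by move=> n; exact: mf.
  rewrite -(nneseries_addn 1)//; last first.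
    by move=> n; rewrite lee_fin mulr_ge0 ?expR_ge0 ?levy_weight_ge0.
  by apply: eq_eseriesr => n _; rewrite integral_f// addn1.
apply: eq_integral => y _; rewrite sum_f// /base -/S; congr EFin.
rewrite -!mulrA; congr (_ * (_ * _)).
rewrite mulrBr mulr1 -expRD; congr (expR _ - _); ring.
Qed.

End levy_weights.

(** * The Levy measure of the subordinated process *)

Section levy_measure.
Context (R : realType) (k : nat) (lambda : 'I_k -> R) (theta eta : R).
Hypothesis lambda0 : forall j, 0 < lambda j.
Hypothesis theta_gt0 : 0 < theta.
Hypothesis theta_lt1 : theta < 1.
Hypothesis eta_gt0 : 0 < eta.

Let w := levy_weight lambda theta eta.
Let w0 n : 0 <= w n. Proof. exact: levy_weight_ge0. Qed.

Let cst0 : 0 <= theta / Gamma (1 - theta).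
Proof. by rewrite divr_ge0 ?Gamma_ge0// ltW. Qed.

(** Series of measures start at index 0, hence the shift by one. *)
Definition subordinated_levy_measure : {measure set (measurableTypeR R) -> \bar R} :=
  mscale (NngNum cst0) (mseries (fun n =>
    mscale (NngNum (w0 n.+1)) (dirac (n.+1%:R : measurableTypeR R))) 0).

Let Pi := subordinated_levy_measure.

Lemma subordinated_levy_measureE (A : set (measurableTypeR R)) :
  (Pi A = (theta / Gamma (1 - theta))%:E *
    \sum_(1 <= n <oo) ((w n)%:E * \d_(n%:R : measurableTypeR R) A))%E.
Proof.
rewrite -(nneseries_addn 1).
  by rewrite [LHS]/=; congr *%E; apply: eq_eseriesr => n _; rewrite addn1.
by move=> n; rewrite mule_ge0// lee_fin.
Qed.

Lemma ge0_integral_subordinated_levy_measure (g : R -> R) :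
  measurable_fun setT g -> (forall x, 0 <= g x) ->
  (\int[Pi]_x (g x)%:E = (theta / Gamma (1 - theta))%:E *
    \sum_(1 <= n <oo) (g n%:R * w n)%:E)%E.
Proof.
move=> mg g0.
have mg' : measurable_fun [set: measurableTypeR R] (fun x => (g x)%:E).
  exact/measurable_EFinP.
have gE (x : measurableTypeR R) : [set: measurableTypeR R] x -> (0 <= (g x)%:E)%E.
  by move=> _; rewrite lee_fin.
rewrite (ge0_integral_mscale _ measurableT _ mg' gE).
congr *%E.
rewrite (ge0_integral_measure_series _ measurableT gE mg').
rewrite -(nneseries_addn 1); last by move=> n; rewrite lee_fin mulr_ge0.
apply: eq_eseriesr => n _.
rewrite (ge0_integral_mscale _ measurableT _ mg' gE)/=.
rewrite (@integral_dirac _ _ (n.+1%:R : measurableTypeR R) R setT measurableT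
  (fun x => (g x)%:E) mg').
by rewrite diracT mul1e addn1 -EFinM mulrC.
Qed.

Let Gam0 : 0 < Gamma (1 - theta).
Proof.
have t1 : 1 - theta <= 1 by rewrite gerBl ltW.
rewrite GammaE fine_gt0// egamma1_gt0//= egamma_lty// subr_gt0//.
Qed.

Let measurable_exp_norm v : measurable_fun setT (fun x : R => expR (- (v * `|x|))).
Proof.
rewrite (_ : (fun x => _) = tcos v 0); first exact: measurable_tcos.
by apply/funext => x; rewrite /tcos mul0r cos0 mulr1.
Qed.

Lemma subordinated_levy_measure_laplace v : 0 <= v ->
  (\int[Pi]_x (expR (- (v * `|x|)))%:E =
   ((\sum_(j < k) lambda j + eta) `^ theta -
    (eta + laplace_exponent lambda v) `^ theta)%:E)%E.
Proof.
move=> v0.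
rewrite ge0_integral_subordinated_levy_measure; last 2 first.
- exact: measurable_exp_norm.
- by move=> x; exact: expR_ge0.
under eq_eseriesr do rewrite ger0_norm//.
rewrite levy_weight_series// -EFinM; congr EFin; field.
by rewrite (gt_eqF Gam0) (gt_eqF theta_gt0).
Qed.

(** This is the Laplace transform at v = 0. *)
Lemma subordinated_levy_measureT : Pi setT =
  ((\sum_(j < k) lambda j + eta) `^ theta - eta `^ theta)%:E.
Proof.
have := subordinated_levy_measure_laplace (lexx 0).
rewrite (_ : laplace_exponent lambda 0 = 0) ?addr0; last first.
  by apply: big1 => j _; rewrite mul0r oppr0 expR0 subrr mulr0.
move=> <-; under eq_integral do rewrite mul0r oppr0 expR0.
by rewrite integral_cst// mul1e.
Qed.

Lemma subordinated_levy_measure_fin : (Pi setT < +oo)%E.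
Proof. by rewrite subordinated_levy_measureT ltry. Qed.

Lemma subordinated_levy_measure_null (A : set (measurableTypeR R)) :
  (forall n, ~ A n.+1%:R) -> Pi A = 0%E.
Proof.
move=> An; rewrite subordinated_levy_measureE eseries0 ?mule0// => -[//|n] _ _.
by rewrite diracE memNset ?mule0//; exact: An.
Qed.

Lemma subordinated_levy_measure_one_sub_exp v : 0 <= v ->
  \int[Pi]_x one_sub_exp v x =
  (eta + laplace_exponent lambda v) `^ theta - eta `^ theta.
Proof.
move=> v0; rewrite /one_sub_exp RintegralB//; last 2 first.
- apply: (@bounded_integrable _ _ _ _ _ 1) => //; first exact: subordinated_levy_measure_fin.
  by move=> x; rewrite normr1.
- apply: (@bounded_integrable _ _ _ _ _ 1); first exact: subordinated_levy_measure_fin.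
    exact: measurable_exp_norm.
  move=> x; rewrite ger0_norm ?expR_ge0// -[leRHS]expR0 ler_expR oppr_le0.
  exact: mulr_ge0.
rewrite Rintegral_cst// mul1r [X in fine X]subordinated_levy_measureT /=.
by rewrite /Rintegral subordinated_levy_measure_laplace//=; ring.
Qed.

Lemma subordinated_levy_measure_tail :
  \int[Pi]_x @beyond R N x @[N --> \oo] --> 0.
Proof.
pose F (N : nat) : set (measurableTypeR R) := `]N%:R, +oo[%classic.
have mF N : measurable (F N) by exact: measurable_itv.
have cap : \bigcap_n F n = set0.
  apply/seteqP; split => // x Fx.
  have := Fx (Num.truncn x).+1 I; rewrite /F /= in_itv/= andbT.
  by rewrite ltNge (ltW (truncnS_gt _)).
have cv : Pi \o F @ \oo --> Pi (\bigcap_n F n).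
  apply: nonincreasing_cvg_mu => //.
  - apply: le_lt_trans subordinated_levy_measure_fin.
    by apply: le_measure => //; rewrite inE.
  - by rewrite cap.
  - move=> m n mn; rewrite subsetEset => x; rewrite /F /= !in_itv/= !andbT.
    by apply: le_lt_trans; rewrite ler_nat.
rewrite cap measure0 in cv.
rewrite (_ : (fun N => _) = fine \o (Pi \o F)); first exact: (fine_cvg cv).
apply/funext => N; rewrite /= /beyond /Rintegral; congr fine.
by rewrite integral_indic ?setIT//; exact: mF.
Qed.

End levy_measure.

(** Since E exp(-v Z_h) = exp(-h f) with f the integral of 1 - e^(-v x) against the
    measure, the limit is known for these functions, and [laplace_cvg] extends
    it. *)
Lemma subordinated_small_time (R : realType) (d : measure_display) (T : measurableType d)
    (P : probability T R) (k : nat) (lambda : 'I_k -> R) (theta eta : R)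
    (D M : R -> T -> R) (lambda0 : forall j, 0 < lambda j)
    (theta_gt0 : 0 < theta) (theta_lt1 : theta < 1) (eta_gt0 : 0 < eta) :
  (1 <= k)%N ->
  tempered_stable_subordinator P eta theta D ->
  generalized_counting_process P lambda M -> independent_processes P M D ->
  small_time_limit P (fun t w => M (D t w) w)
    (fun g => \int[subordinated_levy_measure eta lambda0 theta_gt0]_x g x).
Proof.
move=> k1 HD GM ind g C mg gC g0.
have LD := subordinator_levy (tss_subordinator HD).
have ndD := subordinator_nondecreasing (tss_subordinator HD).
have LM := gcp_levy GM; have ndM := gcp_nondecreasing GM.
set Pi := subordinated_levy_measure _ _ _.
have Pifin := subordinated_levy_measure_fin lambda0 theta_gt0 theta_lt1 eta_gt0.
have D0 h w : 0 <= h -> 0 <= D h w by exact: (subordinator_ge0 LD ndD).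
have mZ h : 0 <= h -> measurable_fun setT (fun w => M (D h w) w).
  by move=> h0; exact: (measurable_subordinated LM ndM LD ndD h0).
have JP h : 0 < h -> natural_positive (fun g => (\int[P]_w g (M (D h w) w)) / h).
  move=> h0; apply: natural_positive_law => //; first exact: mZ (ltW h0).
  by move=> w; apply: (gcp_nat GM); exact: D0 (ltW h0).
apply: (@laplace_cvg R (fun h g => (\int[P]_w g (M (D h w) w)) / h)
  (fun g => \int[Pi]_x g x) JP _ _ _ g C) => //.
- apply: natural_positive_measure => //.
  by apply: subordinated_levy_measure_null => n; apply; exists n.+1.
- move=> v v0.
  rewrite subordinated_levy_measure_one_sub_exp ?(ltW v0)//.
  set f := _ - _.
  have H : - ((expR (h * - f) * cos (h * 0) - 1) / h) @[h --> 0^'+] --> f.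
    rewrite -[X in _ --> X]opprK; apply: cvgN; exact: exp_cos_derive.
  apply: cvg_trans H; apply: near_eq_cvg; near=> h.
  have h0 : 0 < h by near: h; exact: nbhs_right_gt.
  rewrite /= mulr0 cos0 mulr1 -mulNr opprB; congr (_ / _).
  rewrite mulrN -(subordinated_laplace HD GM ind k1 lambda0 v0 (ltW h0)).
  rewrite /one_sub_exp RintegralB//.
  + rewrite Rintegral_cst// mul1r [X in fine X]probability_setT; congr (_ - _).
    by apply: eq_Rintegral => w _; rewrite ger0_norm// (gcp_ge0 GM)// D0// ltW.
  + exact: finite_measure_integrable_cst.
  + apply: (@bounded_integrable _ _ _ _ _ 1) => //; first exact: probability_lty.
      have mc := measurable_tcos v 0.
      have := measurableT_comp mc (mZ h (ltW h0)).
      by apply: eq_measurable_fun => w _; rewrite /= /tcos mul0r cos0 mulr1.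
    move=> w; rewrite ger0_norm ?expR_ge0// -[leRHS]expR0 ler_expR oppr_le0.
    by rewrite mulr_ge0// ltW.
- exact: subordinated_levy_measure_tail.
Unshelve. all: end_near. Qed.

(** For a finite measure the truncated term is integrable by itself, and the drift
    b is chosen to cancel it. *)
Lemma cexp_levy_exponent (R : realType)
    (Pi : {measure set (measurableTypeR R) -> \bar R}) (t u : R) :
  (Pi setT < +oo)%E ->
  let b := \int[Pi]_x (x * (if `|x| <= 1 then 1 else 0)) in
  cexp ((t +i* 0)%C * levy_exponent b 0 Pi u) =
  cexp ((t * \int[Pi]_x (tcos 0 u x - 1)) +i* (t * \int[Pi]_x tsin 0 u x))%C.
Proof.
move=> Pifin b; congr cexp; rewrite /levy_exponent /cintegral.
have Re_part : \int[Pi]_x complex.Re (cexp (0 +i* (u * x))%C - 1 -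
    (0 +i* (u * x * (if `|x| <= 1 then 1 else 0)))%C) = \int[Pi]_x (tcos 0 u x - 1).
  by apply: eq_Rintegral => x _; rewrite /= /tcos mul0r oppr0 addr0.
have m1 : measurable_fun setT (fun x : R => if `|x| <= 1 then x else 0).
  apply: measurable_fun_ifT => //.
  by apply: measurable_fun_ler => //; exact: normr_measurable.
have bm1 (x : R) : `|if `|x| <= 1 then x else 0| <= 1.
  by case: ifP => // _; rewrite normr0.
have trE (x : R) : x * (if `|x| <= 1 then 1 else 0) = if `|x| <= 1 then x else 0.
  by case: ifP; rewrite ?mulr1 ?mulr0.
have it : Pi.-integrable setT (EFin \o (fun x : R => if `|x| <= 1 then x else 0)).
  exact: (@bounded_integrable _ _ _ _ _ 1).
have iut : Pi.-integrable setT (EFin \o (fun x : R => u * (if `|x| <= 1 then x else 0))).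
  exact: (integrableZl measurableT u it).
have is_ : Pi.-integrable setT (EFin \o tsin 0 u).
  apply: (@bounded_integrable _ _ _ _ _ 1) => //; first exact: measurable_tsin.
  by move=> x; exact: tsin_le1.
have Im_part : \int[Pi]_x complex.Im (cexp (0 +i* (u * x))%C - 1 -
    (0 +i* (u * x * (if `|x| <= 1 then 1 else 0)))%C) = \int[Pi]_x tsin 0 u x - u * b.
  rewrite /b; under [X in _ = _ - u * X]eq_Rintegral do rewrite trE.
  rewrite -RintegralZl// -RintegralB//; apply: eq_Rintegral => x _.
  by rewrite /= /tsin mul0r oppr0 addr0 -mulrA trE.
rewrite Re_part Im_part; apply/eqP; rewrite eq_complex /=; apply/andP; split; apply/eqP; ring.
Qed.

Theorem proposition4p4 (R : realType) (d : measure_display)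
    (T : measurableType d) (P : probability T R)
    (k : nat) (lambda : 'I_k -> R) (theta eta : R) (D M : R -> T -> R)
    (k_ge1 : (1 <= k)%N) (lambda_gt0 : forall j, 0 < lambda j)
    (theta_gt0 : 0 < theta) (theta_lt1 : theta < 1) (eta_gt0 : 0 < eta)
    (D_tss : tempered_stable_subordinator P eta theta D)
    (M_gcp : generalized_counting_process P lambda M)
    (M_indep_D : independent_processes P M D) :
  let Lambda := \sum_(j < k) lambda j in
  let Z := fun t w => M (D t w) w in
  exists Pi : {measure set (measurableTypeR R) -> \bar R},
    is_levy_measure P Z Pi /\
    forall A : set (measurableTypeR R), measurable A ->
      Pi A =
      ((theta / Gamma (1 - theta))%:E *
       \sum_(1 <= n <oo)
         ((\sum_(x \in Omega k n)
             let s := (\sum_(j < k) x j)%N%:R in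
             (\prod_(j < k) (lambda j ^+ x j / (x j)`!%:R)) *
             (Gamma (s - theta) / (Lambda + eta) `^ (s - theta)))%R%:E *
          \d_(n%:R : measurableTypeR R) A))%E.
Proof.
move=> Lambda Z.
pose Pi := subordinated_levy_measure eta lambda_gt0 theta_gt0.
exists Pi; split; last first.
  by move=> A _; rewrite /Pi subordinated_levy_measureE.
have LD := subordinator_levy (tss_subordinator D_tss).
have ndD := subordinator_nondecreasing (tss_subordinator D_tss).
have LM := gcp_levy M_gcp; have ndM := gcp_nondecreasing M_gcp.
have LZ : levy_process P Z by exact: subordinated_levy.
have D0 := subordinator_ge0 LD ndD.
have ndZ : nondecreasing_paths Z.
  by move=> w s t s0 st; apply: ndM; [exact: D0|exact: ndD].
have Pifin : (Pi setT < +oo)%E by exact: subordinated_levy_measure_fin.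
have small := @subordinated_small_time _ _ _ P _ _ _ _ D M lambda_gt0
  theta_gt0 theta_lt1 eta_gt0 k_ge1 D_tss M_gcp M_indep_D.
split => //.
- by apply: subordinated_levy_measure_null => n /= /eqP; rewrite pnatr_eq0.
- apply: le_lt_trans Pifin; rewrite -[leRHS]mul1e -integral_cst//.
  apply: ge0_le_integral => //.
  + by move=> x _; rewrite lee_fin le_min ler01 sqr_ge0.
  + by apply/measurable_EFinP; apply: measurable_minr.
  + by move=> x _; rewrite lee_fin ge_min lexx.
exists (\int[Pi]_x (x * (if `|x| <= 1 then 1 else 0))), 0; split => // t u t0.
rewrite cexp_levy_exponent//.
have [Hc Hs] := levy_transform_small_time u LZ ndZ small (lexx 0) t0.
rewrite /characteristic_function /cintegral /cexp /= -Hc -Hs.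
(* A characteristic function has the real exponent 0, [tcos] and [tsin] have
   - (v |x|) with v = 0. *)
have tE w : expR 0 = expR (- (0 * `|Z t w|)) by rewrite mul0r oppr0.
by congr (_ +i* _)%C; apply: eq_Rintegral => w _; rewrite (tE w).
Qed.
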